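(* Let $n\ge 1$, let $2<p<\infty$, and let $S$ be a sequence of points in $\mathbb{D}^n$. Suppose that $S$ is $H^p(\mathbb{D}^n)$ interpolating. Then the sequence $S$ is Carleson.
   Context: $\mathbb{D}$ is the open unit disc in $\mathbb{C}$ and $\mathbb{T}$ its boundary. For $1\le p<\infty$, $H^p(\mathbb{D}^n)$ is the space of holomorphic functions $f$ on $\mathbb{D}^n$ with $\|f\|_{H^p}^p:=\sup_{r<1}\int_{\mathbb{T}^n}|f(re^{i\theta})|^p\,d\theta<\infty$, where $d\theta$ is Lebesgue measure on $\mathbb{T}^n$ and $e^{i\theta}=(e^{i\theta_1},\dots,e^{i\theta_n})$. For $a\in\mathbb{D}^n$ set $((1-|a|^2)):=\prod_{j=1}^n(1-|a_j|^2)$. A sequence of points $S$ consists of distinct points and is used as its own index set. For $1\le p<\infty$ the restriction operator is $R_pf:=\{((1-|a|^2))^{1/p}f(a)\}_{a\in S}$ for $f\in H^p(\mathbb{D}^n)$. The sequence $S$ is $H^p(\mathbb{D}^n)$ interpolating if $R_p(H^p(\mathbb{D}^n))\supseteq \ell^p(S)$. The sequence $S$ is Carleson if, for some $q\in[1,\infty)$, there is $C>0$ such that $\|R_qf\|_{\ell^q(S)}\le C\|f\|_{H^q(\mathbb{D}^n)}$ for all $f\in H^q(\mathbb{D}^n)$; by a known theorem of A. Chang this property does not depend on $q\in[1,\infty)$. *)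

(* Defs.v *)
From HB Require Import structures.
From mathcomp Require Import all_boot all_order all_algebra.
From mathcomp Require Import all_classical all_reals all_analysis.
From mathcomp Require Import complex.

Set Implicit Arguments.
Unset Strict Implicit.
Unset Printing Implicit Defensive.

Import Order.TTheory GRing.Theory Num.Theory.
Import numFieldNormedType.Exports.

Local Open Scope classical_set_scope.
Local Open Scope ring_scope.

(* The structure is packed as a [numClosedFieldType] because the topology and
   the norm of MathComp-Analysis are attached to such packed structures and are
   not found on the bare type [R[i]]. *)
Definition Cplx (R : realType) : numClosedFieldType := R[i].

(* The modulus as an element of [R]; [`|z|] is its image in [Cplx R]. *)
Definition modulus (R : realType) (z : Cplx R) : R := ComplexField.Normc.normc z.

(* Lebesgue measure (of total mass [(2 * pi) ^+ n]) on the angles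
   [(theta_1, ..., theta_n)] in [[0, 2 * pi]^n], which parametrize [T^n]: the
   [n]-fold product of the Lebesgue measure on [[0, 2 * pi]]. *)
Section torus_measure.
Variable R : realType.
Local Notation T := (measurableTypeR R).

Let arc : set T := `[0, 2 * pi]%classic.

Let measurable_arc : measurable arc.
Proof. exact: measurable_itv. Qed.

Let arc_lty : (lebesgue_measure arc < +oo)%E.
Proof. by rewrite /arc lebesgue_measure_itv/=; case: ifP; rewrite ?ltry. Qed.

Definition arc_measure : {finite_measure set T -> \bar R} :=
  mfrestr measurable_arc arc_lty.

Section torus_step.
Variables (n : nat) (mu : {finite_measure set (n.-tuple T) -> \bar R}).

Definition tcons (x : T * n.-tuple T) : n.+1.-tuple T := [tuple of x.1 :: x.2].

Lemma measurable_tcons : measurable_fun setT tcons.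
Proof. exact: measurable_cons. Qed.

Definition torus_step : set (n.+1.-tuple T) -> \bar R :=
  pushforward (arc_measure \x mu)%E tcons.

HB.instance Definition _ :=
  Measure.copy torus_step
    (measure_function_pushforward__canonical__measure_function_Measure
       (arc_measure \x mu)%E measurable_tcons).

Let torus_step_fin : fin_num_fun torus_step.
Proof.
apply: lty_fin_num_fun; rewrite /= /torus_step /pushforward preimage_setT -setXTT.
by rewrite product_measure1E// lte_mul_pinfty ?fin_num_measure// -ge0_fin_numE
           ?fin_num_measure.
Qed.

HB.instance Definition _ :=
  @Measure_isFinite.Build _ _ _ torus_step torus_step_fin.

End torus_step.

Fixpoint torus_measure (n : nat) : {finite_measure set (n.-tuple T) -> \bar R} :=
  match n return {finite_measure set (n.-tuple T) -> \bar R} with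
  | 0 => \d_ ([tuple] : 0.-tuple T)
  | m.+1 => torus_step (torus_measure m)
  end.

Lemma torus_measure_box n (A : 'I_n -> set T) : (forall i, measurable (A i)) ->
  torus_measure n [set t | forall i, A i (tnth t i)] =
  (\prod_(i < n) lebesgue_measure (A i `&` `[0%R, (2 * pi)%R]))%E.
Proof.
elim: n A => [A _|n IHn A mA] /=.
  by rewrite big_ord0 diracE mem_set// => -[].
rewrite big_ord_recl -IHn// /torus_step /pushforward.
set B := [set t | forall i, A (lift ord0 i) (tnth t i)].
have mB : measurable B.
  rewrite (_ : B = \bigcap_(i in [set: 'I_n])
                     (@tnth _ _)^~ i @^-1` A (lift ord0 i)); last first.
    by apply/seteqP; split => t /= Bt i; [move=> _|]; exact: Bt.
  apply: fin_bigcap_measurable => [|i _]; first exact: finite_finset.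
  by rewrite -[X in measurable X]setTI; exact: measurable_tnth.
rewrite (_ : _ @^-1` _ = A ord0 `*` B); first by rewrite product_measure1E.
apply/seteqP; split => [[x t]/= H|[x t]/= [H0 H1] i].
  split; first by have := H ord0; rewrite /tcons/= tnth0.
  by move=> i; have := H (lift ord0 i); rewrite /tcons/= tnthS.
by case: (unliftP ord0 i) => [j ->|->]; rewrite /tcons/= ?tnthS ?tnth0//; exact: H1.
Qed.

End torus_measure.

Section hardy.
Variables (R : realType) (n : nat).
Local Notation C := (Cplx R).
Implicit Types (f u : 'rV[C]_n -> C) (S : set 'rV[C]_n) (p q : R).

Definition polydisc : set 'rV[C]_n := [set z | forall j, modulus (z 0 j) < 1].

Definition holomorphic f := forall z, polydisc z -> differentiable f z.

(* The point [r e^{i theta}]. *)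
Definition polar (r : R) (theta : n.-tuple (measurableTypeR R)) : 'rV[C]_n :=
  \row_j ((r * cos (tnth theta j)) +i* (r * sin (tnth theta j)))%C.

Definition hardy_norm_pow p f : \bar R :=
  ereal_sup [set (\int[torus_measure R n]_theta
                    (modulus (f (polar r theta)) `^ p)%:E)%E
            | r in `[0, 1[].

Definition hardy_norm p f : \bar R := (hardy_norm_pow p f `^ p^-1)%E.

Definition hardy p : set ('rV[C]_n -> C) :=
  [set f | holomorphic f /\ (hardy_norm_pow p f < +oo)%E].

Definition weight (a : 'rV[C]_n) : R := \prod_j (1 - modulus (a 0 j) ^+ 2).

Definition restriction p f : 'rV[C]_n -> C :=
  fun a => (weight a `^ p^-1)%:C%C * f a.

(* Families indexed by [S] are represented by functions on the ambient space, of
   which only the values on [S] matter. *)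
Definition ell_norm S p u : \bar R :=
  ((\esum_(a in S) (modulus (u a) `^ p)%:E) `^ p^-1)%E.

Definition ell S p : set ('rV[C]_n -> C) := [set u | (ell_norm S p u < +oo)%E].

(* A sequence of distinct points used as its own index set is a countable set,
   finite or infinite. *)
Definition point_sequence S := countable S /\ S `<=` polydisc.

Definition interpolating p S :=
  forall u, ell S p u -> exists2 f, hardy p f & forall a, S a -> restriction p f a = u a.

Definition carleson S :=
  exists q, 1 <= q /\
  exists2 K : R, 0 < K &
    forall f, hardy q f ->
      (ell_norm S q (restriction q f) <= K%:E * hardy_norm q f)%E.

End hardy.

(* Main.v *)
From HB Require Import structures.
Require Import Defs.
From mathcomp Require Import all_boot all_order all_algebra.
From mathcomp Require Import all_classical all_reals all_analysis.
From mathcomp Require Import complex measurable_realfun ring lra.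

Set Implicit Arguments.
Unset Strict Implicit.
Unset Printing Implicit Defensive.

Import Order.TTheory GRing.Theory Num.Theory.
Import numFieldNormedType.Exports.

Local Open Scope classical_set_scope.
Local Open Scope ring_scope.

(** An interpolating sequence for [H^p], [p > 2], satisfies the Carleson embedding for the
    exponent [q = p / (p - 2)], the conjugate of [p / 2].

    Interpolation comes with a constant [K]: a family on a finite subset [A] of [S] is
    interpolated by an [f] such that [|f|_p^p] is at most [K] times the [p]-th power of the norm
    of the family ([interpolating_uniform]). Given [c a >= 0] on [A], this yields for each choice
    of signs [e] a function [F e] with values [e a * c a], such that [|F e|_p^p] is at most [K]
    times the sum of the [w a * (c a)^p], where [w] is the weight. The average [rho a] of
    [e a * F e] over the signs has value [c a] at [a], and Bessel's inequality gives
    [sum_a |rho a|^2 <= E |F e|^2] pointwise, where [E] is the mean over the signs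
    ([square_function_family]).

    Let [g] be in [H^q]. The function [g * (rho a)^2] is holomorphic, so its value at [a] is
    controlled by the integral of its modulus against a kernel of size at most [4^n / w a], hence
    [w a * (c a)^2 * |g a| <= 4^n * int |g| |rho a|^2] ([weighted_submean]). Summed over [A], the
    right-hand side is at most [4^n * E int |g| |F e|^2], which Young's inequality for [q] and
    [p / 2] bounds by [4^n * (L * |g|_q^q + k * E |F e|_p^p)], with [k] as small as desired. For
    [(c a)^2 = |g a|^(q - 1)] both [w a * (c a)^2 * |g a|] and [w a * (c a)^p] are equal to
    [w a * |g a|^q]; for a suitable [k] the last term is then at most half of the left-hand side,
    and is absorbed ([carleson_finite]).

    The sub-mean value inequality in the disc follows from Goursat's argument for closed real
    forms with merely differentiable coefficients ([goursat_rectangle]), applied to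
    [f(z) dz / (z - a)] on circles contracting to [a] ([disc_submean]), and is iterated over the
    variables by Tonelli's theorem ([torus_submean]). The uniform constant is obtained by a
    gliding hump: if it does not exist, finitely supported pieces are added up to a family of
    [l^p] all of whose interpolating functions have infinite norm. This uses neither the
    completeness of [H^p] nor normal families. *)

(** * Goursat bisection *)

Section bisection.
Variable R : realType.

(** Goursat's bisection: an additive function of rectangles which, on the rectangles shrinking
    to any given point, is negligible with respect to the square of the perimeter, is zero. *)
Lemma additive_rectangle0 (D : R -> R -> R -> R -> R) (a b c d : R) :
  a <= b -> c <= d ->
  (forall x1 x2 x3 y1 y2, a <= x1 -> x1 <= x2 -> x2 <= x3 -> x3 <= b ->
     c <= y1 -> y1 <= y2 -> y2 <= d ->
     D x1 x3 y1 y2 = D x1 x2 y1 y2 + D x2 x3 y1 y2) ->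
  (forall x1 x2 y1 y2 y3, a <= x1 -> x1 <= x2 -> x2 <= b ->
     c <= y1 -> y1 <= y2 -> y2 <= y3 -> y3 <= d ->
     D x1 x2 y1 y3 = D x1 x2 y1 y2 + D x1 x2 y2 y3) ->
  (forall x y e, a <= x <= b -> c <= y <= d -> 0 < e ->
     exists2 r, 0 < r & forall x1 x2 y1 y2,
       a <= x1 -> x1 <= x -> x <= x2 -> x2 <= b ->
       c <= y1 -> y1 <= y -> y <= y2 -> y2 <= d ->
       x2 - x1 < r -> y2 - y1 < r ->
       `|D x1 x2 y1 y2| <= e * ((x2 - x1) + (y2 - y1)) ^+ 2) ->
  D a b c d = 0.
Proof.
move=> ab cd Dx Dy Dloc.
pose W k := (b - a) / 2 ^+ k; pose L k := (d - c) / 2 ^+ k.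
have WS k : W k = W k.+1 + W k.+1 by rewrite /W exprS; field.
have LS k : L k = L k.+1 + L k.+1 by rewrite /L exprS; field.
have W0 k : 0 <= W k by rewrite /W divr_ge0 ?subr_ge0// exprn_ge0.
have L0 k : 0 <= L k by rewrite /L divr_ge0 ?subr_ge0// exprn_ge0.
pose ok k (z : R * R) := [/\ a <= z.1, z.1 + W k <= b, c <= z.2, z.2 + L k <= d &
  `|D a b c d| <= 4 ^+ k * `|D z.1 (z.1 + W k) z.2 (z.2 + L k)|].
pose next (s t : {kz : nat * (R * R) | ok kz.1 kz.2}) :=
  [/\ (sval t).1 = (sval s).1.+1,
      (sval s).2.1 <= (sval t).2.1 <= (sval s).2.1 + W (sval t).1 &
      (sval s).2.2 <= (sval t).2.2 <= (sval s).2.2 + L (sval t).1].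
have ok0 : ok 0%N (a, c).
  rewrite /ok /W /L /= expr0 !divr1 mul1r !subrKC; split=> //.
(* At each step, keep a quarter on which [|D|] is at least a fourth of its former value. *)
have [f [f0 fS]] : exists f : nat -> {kz : nat * (R * R) | ok kz.1 kz.2},
    f 0%N = exist _ (0%N, (a, c)) ok0 /\ forall n, next (f n) (f n.+1).
  have [|f [f0 fS]] := @dependent_choice _ next _ (exist _ (0%N, (a, c)) ok0); last by exists f.
  move=> s; apply/cid; case: s => [[k [x y]] [/= ax xb cy yd hD]].
  have [Wk Lk] := (WS k, LS k).
  have := (W0 k.+1, L0 k.+1) => -[W1 L1].
  suff [x' [y' [hx hy hx' hy' hok]]] : exists x' y', [/\ x <= x' <= x + W k.+1,
      y <= y' <= y + L k.+1, x' + W k.+1 <= b, y' + L k.+1 <= d & 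
      `|D a b c d| <= 4 ^+ k.+1 * `|D x' (x' + W k.+1) y' (y' + L k.+1)|].
    have ok' : ok k.+1 (x', y') by rewrite /ok /=; split => //; lra.
    by exists (exist _ (k.+1, (x', y')) ok'); rewrite /next.
  have [r1 r2 r3 r4] : [/\ x <= x + W k.+1, x + W k.+1 <= x + W k,
      y <= y + L k.+1 & y + L k.+1 <= y + L k].
    by clear -Wk Lk W1 L1; split; lra.
  have r7 : y <= y + L k by rewrite lerDl.
  have [r5 r6] : x + W k.+1 <= b /\ a <= x + W k.+1.
    by clear -ax xb Wk W1; split; lra.
  move: hD; rewrite (@Dx x (x + W k.+1) (x + W k)); try by [].
  rewrite (@Dy x (x + W k.+1) y (y + L k.+1) (y + L k)); try by [].
  rewrite (@Dy (x + W k.+1) (x + W k) y (y + L k.+1) (y + L k)); try by [].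
  have -> : x + W k = x + W k.+1 + W k.+1 by lra.
  have -> : y + L k = y + L k.+1 + L k.+1 by lra.
  set A1 := D x (x + W k.+1) y _.
  set A2 := D x (x + W k.+1) (y + _) _.
  set A3 := D (x + W k.+1) _ y _.
  set A4 := D (x + W k.+1) _ (y + _) _ => hD.
  have E4 : (4 : R) ^+ k.+1 = 4 * 4 ^+ k by rewrite exprS.
  have P4 : (0 : R) < 4 ^+ k by rewrite exprn_gt0.
  have hA : `|D a b c d| <= 4 ^+ k * (`|A1| + `|A2| + (`|A3| + `|A4|)).
    apply: le_trans hD _; rewrite ler_pM2l//.
    by apply: le_trans (ler_normD _ _) _; apply: lerD; exact: ler_normD.
  have [h1|h1] := leP `|D a b c d| (4 ^+ k.+1 * `|A1|).
    by exists x, y; clear -Wk Lk W1 L1 h1 ax xb cy yd; split=> //; lra.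
  have [h2|h2] := leP `|D a b c d| (4 ^+ k.+1 * `|A2|).
    by exists x, (y + L k.+1); clear -Wk Lk W1 L1 h2 ax xb cy yd; split=> //; lra.
  have [h3|h3] := leP `|D a b c d| (4 ^+ k.+1 * `|A3|).
    by exists (x + W k.+1), y; clear -Wk Lk W1 L1 h3 ax xb cy yd; split=> //; lra.
  have [h4|h4] := leP `|D a b c d| (4 ^+ k.+1 * `|A4|).
    by exists (x + W k.+1), (y + L k.+1); clear -Wk Lk W1 L1 h4 ax xb cy yd; split=> //; lra.
  by exfalso; rewrite E4 in h1 h2 h3 h4; lra.
have fk n : (sval (f n)).1 = n.
  by elim: n => [|n IH]; [rewrite f0|have [-> _ _] := fS n; rewrite IH].
pose u n := (sval (f n)).2.1; pose v n := (sval (f n)).2.2.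
have uS n : u n <= u n.+1 <= u n + W n.+1 by have [+ + _] := fS n; rewrite fk.
have vS n : v n <= v n.+1 <= v n + L n.+1 by have [+ _ +] := fS n; rewrite fk.
have okf n : ok n (u n, v n) by have := svalP (f n); rewrite fk.
(* Nested intervals [w n, w n + M n] have a common point. *)
have nested (w M : nat -> R) : (forall n, M n = M n.+1 + M n.+1) -> (forall n, 0 <= M n) ->
    (forall n, w n <= w n.+1 <= w n + M n.+1) ->
    exists x, forall n, w n <= x <= w n + M n.
  move=> MS M0 wS.
  have wi m k : w m <= w (m + k)%N.
    elim: k => [|k IH]; first by rewrite addn0.
    by rewrite addnS (le_trans IH)//; have /andP[] := wS (m + k)%N.
  have wd m k : w (m + k)%N + M (m + k)%N <= w m + M m.
    elim: k => [|k IH]; first by rewrite addn0.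
    by rewrite addnS (le_trans _ IH)//; have := wS (m + k)%N; have := MS (m + k)%N; lra.
  have wub m n : w m <= w n + M n.
    have h1 := wi m n; have h2 := wd n m; have := M0 (n + m)%N.
    by rewrite addnC in h1; lra.
  have hs : has_sup (range w).
    by split; [exists (w 0%N), 0%N|exists (w 0%N + M 0%N) => _ [m _ <-]].
  exists (sup (range w)) => n; apply/andP; split.
    by apply: sup_upper_bound => //; exists n.
  by apply: ge_sup; [exists (w 0%N), 0%N|move=> _ [m _ <-]].
have [x hx] := nested u W WS W0 uS.
have [y hy] := nested v L LS L0 vS.
have hx0 := hx 0%N; have hy0 := hy 0%N.
have [/= ax0 xb0 cy0 yd0 _] := okf 0%N.
have abx : a <= x <= b by lra.
have cdy : c <= y <= d by lra.
pose T := ((b - a) + (d - c)) ^+ 2.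
have T0 : 0 <= T by rewrite sqr_ge0.
have small e : 0 < e -> `|D a b c d| <= e * T.
  move=> e0; have [r r0 hr] := Dloc x y e abx cdy e0.
  have [k [hW hL]] : exists k, W k < r /\ L k < r.
    pose m := (Num.truncn ((b - a) / r) + Num.truncn ((d - c) / r)).+1.
    exists m; have m2 : (m%:R : R) < 2 ^+ m by rewrite -natrX ltr_nat ltn_expl.
    have t1 := truncnS_gt ((b - a) / r); have t2 := truncnS_gt ((d - c) / r).
    have m1 : (b - a) / r < m%:R.
      by apply: lt_le_trans t1 _; rewrite ler_nat ltnS leq_addr.
    have m3 : (d - c) / r < m%:R.
      by apply: lt_le_trans t2 _; rewrite ler_nat ltnS leq_addl.
    rewrite /W /L !ltr_pdivrMr ?exprn_gt0//.
    rewrite ltr_pdivrMr// in m1; rewrite ltr_pdivrMr// in m3.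
    split; [apply: lt_trans m1 _|apply: lt_trans m3 _];
      by rewrite mulrC ltr_pM2l.
  have [/= ax xb cy yd hD] := okf k.
  apply: le_trans hD _.
  have hxk := hx k; have hyk := hy k.
  have : `|D (u k) (u k + W k) (v k) (v k + L k)| <= e * (W k + L k) ^+ 2.
    have := hr (u k) (u k + W k) (v k) (v k + L k).
    have -> : u k + W k - u k = W k by rewrite addrC addKr.
    have -> : v k + L k - v k = L k by rewrite addrC addKr.
    by case/andP: hxk => xk1 xk2; case/andP: hyk => yk1 yk2; exact.
  have P4 : (0 : R) < 4 ^+ k by rewrite exprn_gt0.
  rewrite -(ler_pM2l P4) => /le_trans; apply.
  have -> : e * T = 4 ^+ k * (e * (W k + L k) ^+ 2); last by [].
  rewrite /W /L /T -mulrDl expr_div_n -exprM mulnC exprM.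
  have -> : (2 : R) ^+ 2 = 4 by rewrite expr2 -natrM.
  by field; rewrite ?expf_neq0//; lra.
apply/eqP; rewrite -normr_eq0 eq_le normr_ge0 andbT.
apply/ler_addgt0Pr => e e0; rewrite add0r.
have T1 : 0 < T + 1 by lra.
have eT : 0 < e / (T + 1) by rewrite divr_gt0.
apply: le_trans (small _ eT) _.
by rewrite -mulrA ger_pMr// ler_pdivrMl// mulr1; lra.
Qed.

End bisection.

(** * Gradients of functions of two real variables *)

Section gradient.
Variable R : realType.
Local Notation mu := (@lebesgue_measure R).
Implicit Types (F G : R * R -> R) (z : R * R).

(** [F] has gradient [(A, B)] at [z], in the sense of Frechet. *)
Definition gradient F z (A B : R) := is_diff z F (fun h => A * h.1 + B * h.2).

Lemma gradient_differentiable F z A B : gradient F z A B -> differentiable F z.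
Proof. by move=> gF; exact: (@ex_diff _ _ _ _ _ _ _ gF). Qed.

Lemma gradient_approx F z A B : gradient F z A B -> forall e, 0 < e ->
  exists2 r, 0 < r & forall x y, `|x - z.1| < r -> `|y - z.2| < r ->
    `|F (x, y) - F z - (A * (x - z.1) + B * (y - z.2))| <= e * (`|x - z.1| + `|y - z.2|).
Proof.
move=> gF e e0; have dF := gradient_differentiable gF.
have /eqaddoP /(_ e e0) := diff_locally dF.
rewrite (@diff_val _ _ _ _ _ _ _ gF) => /nbhs_ballP [r /= r0 hr]; exists r => // x y hx hy.
have := hr ((x, y) - z).
rewrite -ball_normE /ball_ /= sub0r normrN.
have zE : (x, y) - z = (x - z.1, y - z.2) by [].
rewrite zE /= => H.
have zK : (x - z.1, y - z.2) + z = (x, y) by rewrite -zE subrK.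
have {}H : `|F (x, y) - (F z + (A * (x - z.1) + B * (y - z.2)))| <= e * `|(x - z.1, y - z.2)|.
  rewrite -[X in F X]zK; apply: H.
  by rewrite prod_normE /= gt_max hx hy.
rewrite opprD addrA in H; apply: le_trans H _; rewrite ler_pM2l//.
by rewrite prod_normE /= ge_max lerDl lerDr !normr_ge0.
Qed.

Lemma gradient_eq F z A B A' B' :
  A = A' -> B = B' -> gradient F z A B -> gradient F z A' B'.
Proof. by move=> -> ->. Qed.

Lemma gradient_continuous F z A B : gradient F z A B -> {for z, continuous F}.
Proof. by move=> /gradient_differentiable; exact: differentiable_continuous. Qed.

Lemma gradientD F G z A B A' B' : gradient F z A B -> gradient G z A' B' ->
  gradient (fun w => F w + G w) z (A + A') (B + B').
Proof.
move=> gF gG; apply: (@is_diff_eq _ _ _ _ _ _ _ (is_diffD gF gG)).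
apply/funext => h.
by rewrite [LHS](_ : _ = (A * h.1 + B * h.2) + (A' * h.1 + B' * h.2))//; ring.
Qed.

Lemma gradientM F G z A B A' B' : gradient F z A B -> gradient G z A' B' ->
  gradient (fun w => F w * G w) z (F z * A' + G z * A) (F z * B' + G z * B).
Proof.
move=> gF gG; apply: (@is_diff_eq _ _ _ _ _ _ _ (is_diffM gF gG)).
apply/funext => h.
by rewrite [LHS](_ : _ = F z * (A' * h.1 + B' * h.2) + G z * (A * h.1 + B * h.2))//; ring.
Qed.

Lemma gradient_cst k z : gradient (fun=> k) z 0 0.
Proof.
apply: (@is_diff_eq _ _ _ _ _ _ _ (is_diff_cst k z)).
by apply/funext => h /=; rewrite !mul0r addr0.
Qed.

Lemma gradient_comp1 (phi : R -> R) G z A B k : gradient G z A B ->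
  is_derive (G z) 1 phi k -> gradient (phi \o G) z (k * A) (k * B).
Proof.
move=> gG dphi.
have dp : differentiable phi (G z) by apply/derivable1_diffP; apply: ex_derive.
have gp : is_diff (G z) phi (fun h => h * k).
  apply: DiffDef => //; rewrite diff1E//; apply/funext => h.
  by rewrite derive1E derive_val.
apply: (@is_diff_eq _ _ _ _ _ _ _ (is_diff_comp gG gp)).
by apply/funext => h /=; ring.
Qed.

Lemma gradient_comp2 (U : R * R -> R) F G z A B A1 B1 A2 B2 :
  gradient F z A1 B1 -> gradient G z A2 B2 -> gradient U (F z, G z) A B ->
  gradient (fun w => U (F w, G w)) z (A * A1 + B * A2) (A * B1 + B * B2).
Proof.
move=> gF gG gU.
apply: (@is_diff_eq _ _ _ _ _ _ _ (is_diff_comp (is_diff_pair gF gG) gU)).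
by apply/funext => h /=; ring.
Qed.

Lemma gradient_fst z : gradient fst z 1 0.
Proof.
pose L : {linear (R * R)%type -> R} := GRing.Linear.clone _ _ _ _ fst _.
have c : continuous L by move=> w; exact: cvg_fst.
apply: (@DiffDef _ _ _ _ _ _ _ (linear_differentiable z c)).
by rewrite (diff_lin z c); apply/funext => h; rewrite /L /=; ring.
Qed.

Lemma gradient_snd z : gradient snd z 0 1.
Proof.
pose L : {linear (R * R)%type -> R} := GRing.Linear.clone _ _ _ _ snd _.
have c : continuous L by move=> w; exact: cvg_snd.
apply: (@DiffDef _ _ _ _ _ _ _ (linear_differentiable z c)).
by rewrite (diff_lin z c); apply/funext => h; rewrite /L /=; ring.
Qed.

End gradient.

(** * Closed forms on rectangles *)

Section green.
Variable R : realType.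
Local Notation mu := (@lebesgue_measure R).
Implicit Types (f : R -> R) (P Q : R * R -> R).

Lemma continuous_integrable_itv f (a b : R) :
  (forall x, a <= x <= b -> {for x, continuous f}) ->
  mu.-integrable `[a, b]%classic (EFin \o f).
Proof.
move=> cf; apply: continuous_compact_integrable; first exact: segment_compact.
by apply: continuous_in_subspaceT => x; rewrite inE /= in_itv /=; exact: cf.
Qed.

Lemma Rintegral_chasles f (a b c : R) : a <= b -> b <= c ->
  (forall x, a <= x <= c -> {for x, continuous f}) ->
  \int[mu]_(x in `[a, c]) f x = \int[mu]_(x in `[a, b]) f x + \int[mu]_(x in `[b, c]) f x.
Proof.
move=> ab bc cf; have fi := continuous_integrable_itv cf.
rewrite -(@Rintegral_itv_obnd_cbnd _ b (BRight c)); last first.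
  by apply: integrableS fi => //; apply: subset_itvr; rewrite bnd_simp.
rewrite -(@Rintegral_itvB _ _ (BLeft a) (BRight c) b) ?bnd_simp//.
by rewrite subrKC.
Qed.

Lemma Rintegral_itv_cst (k a b : R) : a <= b -> \int[mu]_(x in `[a, b]) k = k * (b - a).
Proof.
move=> ab; rewrite Rintegral_cst//.
transitivity (k * fine (lebesgue_measure `[a, b]%classic)) => //.
rewrite lebesgue_measure_itv/= lte_fin.
by have [//|//|->] := ltgtP a b; [lra|rewrite subrr].
Qed.

Lemma Rintegral_itv_approx f (k e a b : R) : a <= b ->
  (forall x, a <= x <= b -> {for x, continuous f}) ->
  (forall x, a <= x <= b -> `|f x - k| <= e) ->
  `|\int[mu]_(x in `[a, b]) f x - k * (b - a)| <= e * (b - a).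
Proof.
move=> ab cf fk; have fi := continuous_integrable_itv cf.
have ci (r : R) : mu.-integrable `[a, b]%classic (EFin \o cst r).
  by apply: continuous_integrable_itv => x _; exact: cst_continuous.
rewrite ler_distl -mulrBl -mulrDl -!Rintegral_itv_cst//.
apply/andP; split; apply: le_Rintegral => //; do ?exact: ci.
- by move=> x /=; rewrite in_itv/= => /fk; rewrite ler_distl => /andP[].
- by move=> x /=; rewrite in_itv/= => /fk; rewrite ler_distl => /andP[].
Qed.

Lemma Rintegral_itv_sub f g (a b : R) :
  mu.-integrable `[a, b]%classic (EFin \o f) -> mu.-integrable `[a, b]%classic (EFin \o g) ->
  \int[mu]_(x in `[a, b]) (f x - g x) =
  \int[mu]_(x in `[a, b]) f x - \int[mu]_(x in `[a, b]) g x.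
Proof. by move=> fi gi; exact: RintegralB. Qed.

(** Green's theorem for a closed form [P dx + Q dy] whose coefficients are merely
    differentiable: its integral along the boundary of a rectangle vanishes. Since the partial
    derivatives need not be continuous, the proof goes by bisection. *)
Lemma goursat_rectangle P Q (a b c d : R) : a <= b -> c <= d ->
  (forall x y, a <= x <= b -> c <= y <= d ->
     exists A B C, gradient P (x, y) A C /\ gradient Q (x, y) C B) ->
  \int[mu]_(x in `[a, b]) (P (x, c) - P (x, d)) +
  \int[mu]_(y in `[c, d]) (Q (b, y) - Q (a, y)) = 0.
Proof.
move=> ab cd PQ.
have cP x y : a <= x <= b -> c <= y <= d -> {for x, continuous (fun x => P (x, y))}.
  move=> hx hy; have [A [B [C [gP _]]]] := PQ _ _ hx hy.
  apply: (@continuous_comp _ _ _ (fun x : R => (x, y)) P); last exact: gradient_continuous gP.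
  exact: (@cvg_pair _ _ _ (nbhs x) (nbhs x) (nbhs y) _ _ _ id (fun=> y) cvg_id (cvg_cst _)).
have cQ x y : a <= x <= b -> c <= y <= d -> {for y, continuous (fun y => Q (x, y))}.
  move=> hx hy; have [A [B [C [_ gQ]]]] := PQ _ _ hx hy.
  apply: (@continuous_comp _ _ _ (fun y : R => (x, y)) Q); last exact: gradient_continuous gQ.
  exact: (@cvg_pair _ _ _ (nbhs y) (nbhs x) (nbhs y) _ _ _ (fun=> x) id (cvg_cst _) cvg_id).
have cPB x y y' : a <= x <= b -> c <= y <= d -> c <= y' <= d ->
    {for x, continuous (fun x => P (x, y) - P (x, y'))}.
  by move=> hx hy hy'; apply: continuousB; exact: cP.
have cQB x x' y : a <= x <= b -> a <= x' <= b -> c <= y <= d ->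
    {for y, continuous (fun y => Q (x', y) - Q (x, y))}.
  by move=> hx hx' hy; apply: continuousB; exact: cQ.
have iP x1 x2 y : a <= x1 -> x2 <= b -> c <= y <= d ->
    mu.-integrable `[x1, x2]%classic (EFin \o (fun x => P (x, y))).
  by move=> ax xb hy; apply: continuous_integrable_itv => x hx; apply: cP => //; lra.
have iQ x y1 y2 : a <= x <= b -> c <= y1 -> y2 <= d ->
    mu.-integrable `[y1, y2]%classic (EFin \o (fun y => Q (x, y))).
  by move=> hx ax xb; apply: continuous_integrable_itv => y hy; apply: cQ => //; lra.
pose D x1 x2 y1 y2 := \int[mu]_(x in `[x1, x2]) (P (x, y1) - P (x, y2)) +
                      \int[mu]_(y in `[y1, y2]) (Q (x2, y) - Q (x1, y)).
apply: (@additive_rectangle0 _ D) => //.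
- move=> x1 x2 x3 y1 y2 ax1 x12 x23 x3b cy1 y12 y2d.
  rewrite /D (@Rintegral_chasles _ x1 x2 x3)//; last first.
    by move=> x hx; apply: cPB; lra.
  rewrite !(@Rintegral_itv_sub _ _ y1 y2); try by apply: iQ; lra.
  by lra.
- move=> x1 x2 y1 y2 y3 ax1 x12 x2b cy1 y12 y23 y3d.
  rewrite /D (@Rintegral_chasles _ y1 y2 y3)//; last first.
    by move=> y hy; apply: cQB; lra.
  rewrite !(@Rintegral_itv_sub _ _ x1 x2); try by apply: iP; lra.
  by lra.
move=> x y e hx hy e0; have [A [B [C [gP gQ]]]] := PQ _ _ hx hy.
have e2 : 0 < e / 2 by lra.
have [r1 r10 h1] := gradient_approx gP e2.
have [r2 r20 h2] := gradient_approx gQ e2.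
exists (Num.min r1 r2); first by rewrite lt_min r10.
move=> x1 x2 y1 y2 ax1 x1x xx2 x2b cy1 y1y yy2 y2d.
rewrite !lt_min => /andP[dx1 dx2] /andP[dy1 dy2].
set w := x2 - x1; set l := y2 - y1.
have near (z z1 z2 t s : R) : z1 <= z -> z <= z2 -> z1 <= t <= z2 -> z2 - z1 < s ->
    `|t - z| <= z2 - z1 /\ `|t - z| < s.
  clear; move=> ? ? ? ?; have : `|t - z| <= z2 - z1 by rewrite ler_norml; lra.
  by move=> ht; split => //; lra.
(* With [C] the common partial derivative, the horizontal sides contribute [- C * l * w] and
   the vertical ones [C * w * l], up to errors. *)
have bP : `|\int[mu]_(t in `[x1, x2]) (P (t, y1) - P (t, y2)) - (- C * l) * w| <= e * (w + l) * w.
  apply: Rintegral_itv_approx; [exact: le_trans x1x xx2| |].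
    by move=> t ht; apply: cPB; clear -ht ax1 x2b cy1 y2d y1y yy2; lra.
  move=> t ht; have [t1 t2] := near _ _ _ t _ x1x xx2 ht dx1.
  have [|s1 s2] := near _ _ _ y1 _ y1y yy2 _ dy1; first by rewrite lexx (le_trans y1y yy2).
  have [|u1 u2] := near _ _ _ y2 _ y1y yy2 _ dy1; first by rewrite lexx (le_trans y1y yy2).
  have := h1 t y1 t2 s2; have := h1 t y2 t2 u2.
  set M2 := `|_ - _ - _|; set M1 := `|_ - _ - _| => /= k2 k1.
  have : `|P (t, y1) - P (t, y2) - - C * l| <= M1 + M2.
    apply: le_trans (ler_normB _ _); rewrite le_eqVlt; apply/orP; left; apply/eqP.
    by congr `|_|; rewrite /l /=; ring.
  move=> /le_trans; apply; rewrite -/w -/l in t1 s1 u1.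
  by clear -k1 k2 t1 s1 u1 e0; nra.
have bQ : `|\int[mu]_(t in `[y1, y2]) (Q (x2, t) - Q (x1, t)) - (C * w) * l| <= e * (w + l) * l.
  apply: Rintegral_itv_approx; [exact: le_trans y1y yy2| |].
    by move=> t ht; apply: cQB; clear -ht cy1 y2d ax1 x2b x1x xx2; lra.
  move=> t ht; have [t1 t2] := near _ _ _ t _ y1y yy2 ht dy2.
  have [|s1 s2] := near _ _ _ x1 _ x1x xx2 _ dx2; first by rewrite lexx (le_trans x1x xx2).
  have [|u1 u2] := near _ _ _ x2 _ x1x xx2 _ dx2; first by rewrite lexx (le_trans x1x xx2).
  have := h2 x1 t s2 t2; have := h2 x2 t u2 t2.
  set M2 := `|_ - _ - _|; set M1 := `|_ - _ - _| => /= k2 k1.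
  have : `|Q (x2, t) - Q (x1, t) - C * w| <= M2 + M1.
    apply: le_trans (ler_normB _ _); rewrite le_eqVlt; apply/orP; left; apply/eqP.
    by congr `|_|; rewrite /w /=; ring.
  move=> /le_trans; apply; rewrite -/w -/l in t1 s1 u1.
  by clear -k1 k2 t1 s1 u1 e0; nra.
rewrite /D; set IP := \int[mu]_(_ in _) _ in bP *; set IQ := \int[mu]_(_ in _) _ in bQ *.
rewrite (_ : IP + IQ = (IP - - C * l * w) + (IQ - C * w * l)); last by ring.
apply: le_trans (ler_normD _ _) _.
by rewrite (_ : e * (w + l) ^+ 2 = e * (w + l) * w + e * (w + l) * l); [exact: lerD|ring].
Qed.

End green.

(** * Modulus and complex derivative *)

Section modulus_theory.
Variable R : realType.
Local Notation C := (Cplx R).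
Implicit Types (z w : C).

Lemma modulusE z : `|z| = (modulus z)%:C%C.
Proof. by rewrite normc_def; case: z. Qed.

Lemma modulus_ge0 z : 0 <= modulus z.
Proof. by case: z => x y; exact: sqrtr_ge0. Qed.

Lemma modulusM z w : modulus (z * w) = modulus z * modulus w.
Proof. exact: ComplexField.Normc.normcM. Qed.

Lemma modulusV z : modulus z^-1 = (modulus z)^-1.
Proof. exact: ComplexField.Normc.normcV. Qed.

Lemma modulus0 : modulus (0 : C) = 0.
Proof. exact: ComplexField.Normc.normc0. Qed.

Lemma modulusD z w : modulus (z + w) <= modulus z + modulus w.
Proof. exact: le_normcD. Qed.

Lemma modulusN z : modulus (- z) = modulus z.
Proof. exact: normcN. Qed.

Lemma modulusB z w : modulus (z - w) <= modulus z + modulus w.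
Proof. by rewrite -(modulusN w); exact: modulusD. Qed.

Lemma modulus_eq0 z : modulus z = 0 -> z = 0.
Proof. exact: ComplexField.Normc.eq0_normc. Qed.

Lemma modulus_real (x : R) : modulus (x%:C%C : C) = `|x|.
Proof. by rewrite /modulus /= expr0n/= addr0 sqrtr_sqr. Qed.

Lemma modulusX z k : modulus (z ^+ k) = modulus z ^+ k.
Proof.
elim: k => [|k IH]; first by rewrite !expr0; exact: ComplexField.Normc.normc1.
by rewrite !exprS modulusM IH.
Qed.

Lemma sqr_modulus z : modulus z ^+ 2 = complex.Re z ^+ 2 + complex.Im z ^+ 2.
Proof. by case: z => x y; rewrite /modulus /= sqr_sqrtr// addr_ge0// sqr_ge0. Qed.

Lemma Re_le_modulus z : `|complex.Re z| <= modulus z.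
Proof.
rewrite -ler_sqr ?nnegrE ?normr_ge0 ?modulus_ge0// sqr_modulus real_normK ?num_real//.
by rewrite lerDl sqr_ge0.
Qed.

Lemma Im_le_modulus z : `|complex.Im z| <= modulus z.
Proof.
rewrite -ler_sqr ?nnegrE ?normr_ge0 ?modulus_ge0// sqr_modulus real_normK ?num_real//.
by rewrite lerDr sqr_ge0.
Qed.

Lemma modulus_le_ReIm z : modulus z <= `|complex.Re z| + `|complex.Im z|.
Proof.
rewrite -ler_sqr ?nnegrE ?modulus_ge0 ?addr_ge0// sqr_modulus sqrrD.
by rewrite !real_normK ?num_real// lerD2r lerDl mulrn_wge0 ?mulr_ge0.
Qed.

End modulus_theory.

Section complex_derivative.
Variable R : realType.
Local Notation C := (Cplx R).

Lemma gradient_intro (F : R * R -> R) (x y A B : R) :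
  (forall e, 0 < e -> exists2 r, 0 < r & forall s t, `|s| < r -> `|t| < r ->
    `|F (x + s, y + t) - F (x, y) - (A * s + B * t)| <= e * (`|s| + `|t|)) ->
  gradient F (x, y) A B.
Proof.
move=> hF.
pose d (h : R * R) := A * h.1 + B * h.2.
have dl : linear d by move=> k [u v] [u' v']; rewrite /d /= /GRing.scale /=; ring.
pose L : {linear (R * R)%type -> R} := HB.pack d (GRing.isLinear.Build _ _ _ _ _ dl).
have cL : continuous L.
  move=> z; apply: (@continuousD _ _ _ (fun h : R * R => A * h.1) (fun h : R * R => B * h.2)).
    by apply: continuousM; [exact: cst_continuous|exact: cvg_fst].
  by apply: continuousM; [exact: cst_continuous|exact: cvg_snd].
have FL : F \o shift (x, y) = cst (F (x, y)) + L +o_ (0 : R * R) id.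
  apply/eqaddoP => e e0.
  have [r r0 hr] := hF (e / 2) ltac:(lra).
  apply/nbhs_ballP; exists r => // -[s t].
  rewrite -ball_normE /ball_ /= sub0r normrN prod_normE /= gt_max => /andP[hs ht].
  have := hr s t hs ht.
  rewrite (_ : (_ - _) (s, t) = F (x + s, y + t) - F (x, y) - (A * s + B * t)); last first.
    rewrite -addrA -opprD (addrC x) (addrC y).
    by [].
  move=> /le_trans; apply.
  rewrite -mulrA ler_pM2l// ler_pdivrMl// mulr2n mulrDl !mul1r.
  by apply: lerD; rewrite le_max lexx ?orbT.
have dE := diff_unique cL FL.
apply: DiffDef; last by rewrite dE.
by apply/diff_locallyP; rewrite dE.
Qed.

(** [c] is the complex derivative of [f] at [z]. *)
Definition cderiv (f : C -> C) (z c : C) := forall e : R, 0 < e ->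
  exists2 r, 0 < r & forall t, modulus t < r ->
    modulus (f (z + t) - f z - c * t) <= e * modulus t.

(** The Cauchy-Riemann equations, read on the gradients of the real and imaginary
    parts. *)
Lemma cderiv_gradient f (x y A B : R) : cderiv f (x +i* y)%C (A +i* B)%C ->
  gradient (fun w => complex.Re (f (w.1 +i* w.2)%C)) (x, y) A (- B) /\
  gradient (fun w => complex.Im (f (w.1 +i* w.2)%C)) (x, y) B A.
Proof.
move=> df; split; apply: gradient_intro => e e0; have [r r0 hr] := df e e0;
  exists (r / 2); try lra; move=> s t hs ht.
- have st : modulus (s +i* t : C)%C <= `|s| + `|t| := modulus_le_ReIm _.
  have /hr : modulus (s +i* t : C)%C < r by apply: le_lt_trans st _; lra.
  set D := (X in modulus X) => hD.
  have -> : complex.Re (f ((x + s) +i* (y + t))%C) - complex.Re (f (x +i* y)%C) - (A * s + - B * t)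
     = complex.Re D.
    rewrite /D; have -> : (x +i* y)%C + (s +i* t)%C = ((x + s) +i* (y + t))%C :> C by [].
    by move: (f _) (f _) => [u v] [u' v'] /=; ring.
  by apply: le_trans (Re_le_modulus _) _; apply: le_trans hD _; rewrite ler_pM2l.
- have st : modulus (s +i* t : C)%C <= `|s| + `|t| := modulus_le_ReIm _.
  have /hr : modulus (s +i* t : C)%C < r by apply: le_lt_trans st _; lra.
  set D := (X in modulus X) => hD.
  have -> : complex.Im (f ((x + s) +i* (y + t))%C) - complex.Im (f (x +i* y)%C) - (B * s + A * t)
     = complex.Im D.
    rewrite /D; have -> : (x +i* y)%C + (s +i* t)%C = ((x + s) +i* (y + t))%C :> C by [].
    by move: (f _) (f _) => [u v] [u' v'] /=; ring.
  by apply: le_trans (Im_le_modulus _) _; apply: le_trans hD _; rewrite ler_pM2l.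
Qed.

Lemma cderiv_continuous f z c : cderiv f z c -> forall e, 0 < e ->
  exists2 r, 0 < r & forall t, modulus t < r -> modulus (f (z + t) - f z) <= e.
Proof.
move=> df e e0; have [r r0 hr] := df 1 ltr01.
pose K := 1 + modulus c.
have K0 : 0 < K by rewrite /K; have := modulus_ge0 c; lra.
exists (Num.min r (e / K)); first by rewrite lt_min r0 divr_gt0.
move=> t; rewrite lt_min => /andP[tr te].
rewrite (_ : f (z + t) - f z = (f (z + t) - f z - c * t) + c * t); last by ring.
apply: le_trans (modulusD _ _) _; apply: le_trans (lerD (hr t tr) (lexx _)) _.
rewrite modulusM -mulrDl -/K; rewrite ltr_pdivlMr// in te.
by rewrite mulrC ltW.
Qed.

End complex_derivative.

(** * The sub-mean value inequality in the disc *)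

Section disc_submean.
Variable R : realType.
Local Notation C := (Cplx R).
Local Notation mu := (@lebesgue_measure R).

(** The point [r e^{i t}]. *)
Definition circle (r t : R) : C := ((r * cos t) +i* (r * sin t))%C.

Lemma modulus_circle r t : 0 <= r -> modulus (circle r t) = r.
Proof.
move=> r0; rewrite /modulus /= !exprMn -mulrDr cos2Dsin2 mulr1.
by rewrite sqrtr_sqr ger0_norm.
Qed.

Lemma continuous_modulus_circle (f : C -> C) r t c : cderiv f (circle r t) c ->
  {for t, continuous (fun t => modulus (f (circle r t)))}.
Proof.
case: c => A B /cderiv_gradient [gu gv].
have ce : {for t, continuous (fun t => (r * cos t, r * sin t))}.
  apply: (@cvg_pair _ _ _ (nbhs t) (nbhs (r * cos t)) (nbhs (r * sin t)) _ _ _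
      (fun t => r * cos t) (fun t => r * sin t)).
    by apply: continuousM; [exact: cst_continuous|exact: continuous_cos].
  by apply: continuousM; [exact: cst_continuous|exact: continuous_sin].
have cu := @continuous_comp _ _ _ (fun t => (r * cos t, r * sin t)) _ t ce (gradient_continuous gu).
have cv := @continuous_comp _ _ _ (fun t => (r * cos t, r * sin t)) _ t ce (gradient_continuous gv).
have -> : (fun t => modulus (f (circle r t))) = fun t => Num.sqrt
   (complex.Re (f (circle r t)) * complex.Re (f (circle r t)) +
    complex.Im (f (circle r t)) * complex.Im (f (circle r t))).
  by apply/funext => s; rewrite /modulus; case: (f _) => x y /=; rewrite !expr2.
apply: (@continuous_comp _ _ _ _ Num.sqrt); last exact: sqrt_continuous.
by apply: continuousD; apply: continuousM.
Qed.

Section kernel.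
Variables (r a1 a2 : R).
Hypotheses (ar : modulus (a1 +i* a2 : C)%C < r).

Let r0 : 0 < r. Proof. by apply: le_lt_trans ar; exact: modulus_ge0. Qed.

(* [K1 t + i K2 t] is the Cauchy kernel [e / (e - a)], where [e = circle r t]. *)
Let N t := (r * cos t - a1) ^+ 2 + (r * sin t - a2) ^+ 2.
Let K1 t := (r ^+ 2 - r * (a1 * cos t + a2 * sin t)) / N t.
Let K2 t := - (r * (a1 * sin t - a2 * cos t)) / N t.

Let NE t : N t = modulus (circle r t - (a1 +i* a2)%C) ^+ 2.
Proof. by rewrite sqr_modulus. Qed.

Let dist t : r - modulus (a1 +i* a2 : C)%C <= modulus (circle r t - (a1 +i* a2)%C).
Proof.
rewrite -[in X in X <= _](@modulus_circle r t (ltW r0)) lerBlDr.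
by apply: le_trans (modulusD _ _); rewrite subrK.
Qed.

Let N_gt0 t : 0 < N t.
Proof. by rewrite NE exprn_gt0//; apply: lt_le_trans (dist t); rewrite subr_gt0. Qed.

Let KE t : (K1 t +i* K2 t : C)%C = circle r t / (circle r t - (a1 +i* a2)%C).
Proof.
have n0 : circle r t - (a1 +i* a2)%C != 0.
  by apply/eqP => e; have := N_gt0 t; rewrite NE e modulus0 expr0n ltxx.
have := lt0r_neq0 (N_gt0 t) => N0.
apply: (mulIf n0); rewrite divfK//.
have cs : sin t ^+ 2 = 1 - cos t ^+ 2 by rewrite -(cos2Dsin2 t); ring.
by apply/eqP; rewrite eq_complex /=; apply/andP; split; apply/eqP; rewrite /K1 /K2;
  move: N0; rewrite /N => N0; field: cs => //.
Qed.

Let modulusK t : modulus (K1 t +i* K2 t : C)%C <= r / (r - modulus (a1 +i* a2 : C)%C).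
Proof.
rewrite KE modulusM modulusV (modulus_circle _ (ltW r0)) ler_pM2l//.
rewrite lef_pV2 ?dist// posrE ?subr_gt0//.
by apply: lt_le_trans (dist t); rewrite subr_gt0.
Qed.

Let K1_ge t : 1 / 2 <= K1 t.
Proof.
rewrite /K1 ler_pdivlMr ?N_gt0//.
have : a1 ^+ 2 + a2 ^+ 2 <= r ^+ 2.
  by rewrite -(sqr_modulus (a1 +i* a2 : C)%C) ler_sqr ?nnegrE ?modulus_ge0 ?(ltW ar) ?(ltW r0).
have := cos2Dsin2 t; rewrite /N => cs h.
have -> : (r * cos t - a1) ^+ 2 + (r * sin t - a2) ^+ 2 = 
   r ^+ 2 * (cos t ^+ 2 + sin t ^+ 2) - 2 * (r * (a1 * cos t + a2 * sin t)) +
   (a1 ^+ 2 + a2 ^+ 2) by ring.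
by rewrite cs; lra.
Qed.

(* [X + i Y] is the point [a + s (e - a)], as a function of [(s, t)]. *)
Let X (w : R * R) := a1 + w.1 * (r * cos w.2 - a1).
Let Y (w : R * R) := a2 + w.1 * (r * sin w.2 - a2).

Let gradient_snd_comp (phi : R -> R) (s t k : R) : is_derive t 1 phi k ->
  gradient (fun w => phi w.2) (s, t) 0 k.
Proof.
move=> h; have := gradient_comp1 (gradient_snd (s, t)) h.
by apply: gradient_eq; rewrite ?mulr0 ?mulr1.
Qed.

Let gradX s t : gradient X (s, t) (r * cos t - a1) (- (s * (r * sin t))).
Proof.
have h : is_derive t 1 (fun t => r * cos t - a1) (- (r * sin t)).
  by apply: is_derive_eq; rewrite /GRing.scale /=; ring.
have := gradientD (gradient_cst a1 (s, t))
  (gradientM (gradient_fst (s, t)) (gradient_snd_comp s h)).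
by apply: gradient_eq => /=; ring.
Qed.

Let gradY s t : gradient Y (s, t) (r * sin t - a2) (s * (r * cos t)).
Proof.
have h : is_derive t 1 (fun t => r * sin t - a2) (r * cos t).
  by apply: is_derive_eq; rewrite /GRing.scale /=; ring.
have := gradientD (gradient_cst a2 (s, t))
  (gradientM (gradient_fst (s, t)) (gradient_snd_comp s h)).
by apply: gradient_eq => /=; ring.
Qed.

Let XY_lt1 s t : r < 1 -> 0 <= s <= 1 -> modulus (X (s, t) +i* Y (s, t) : C)%C < 1.
Proof.
move=> r1 /andP[s0 s1].
have -> : (X (s, t) +i* Y (s, t))%C = (1 - s)%:C%C * (a1 +i* a2)%C + s%:C%C * circle r t :> C.
  by apply/eqP; rewrite eq_complex /X /Y /=; apply/andP; split; apply/eqP; ring.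
apply: le_lt_trans (modulusD _ _) _; rewrite !modulusM !modulus_real (modulus_circle _ (ltW r0)).
rewrite !ger0_norm ?subr_ge0//.
apply: le_lt_trans r1.
have : (1 - s) * modulus (a1 +i* a2 : C)%C <= (1 - s) * r.
  by rewrite ler_wpM2l ?subr_ge0 ?(ltW ar).
lra.
Qed.

(** With [e = circle r t], the form [Im (f (X, Y)) / s ds + Re (f (X, Y) e / (e - a)) dt]
    is the real part of [- i f(z) dz / (z - a)] along [z = a + s (e - a)]. *)
Let closed_form (f : C -> C) s t : r < 1 -> 0 < s <= 1 ->
  (forall z, modulus z < 1 -> exists c, cderiv f z c) ->
  exists A B D,
    gradient (fun w => complex.Im (f (X w +i* Y w)%C) * w.1^-1) (s, t) A D /\
    gradient (fun w => complex.Re (f (X w +i* Y w)%C) * K1 w.2 -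
                       complex.Im (f (X w +i* Y w)%C) * K2 w.2) (s, t) D B.
Proof.
move=> r1 /andP[s0 s1] df.
have [|[A B] /cderiv_gradient [gu gv]] := df (X (s, t) +i* Y (s, t))%C.
  by apply: XY_lt1 => //; rewrite (ltW s0).
have {}gu := gradient_comp2 (gradX s t) (gradY s t) gu.
have {}gv := gradient_comp2 (gradX s t) (gradY s t) gv.
have dN : derivable N t 1 by apply: ex_derive.
have N0 := lt0r_neq0 (N_gt0 t).
have dK1 : derivable K1 t 1.
  by apply: derivableM; [apply: ex_derive|exact: (derivableV N0 dN)].
have dK2 : derivable K2 t 1.
  apply: (@derivableM _ _ (fun t => - (r * (a1 * sin t - a2 * cos t))) (fun t => (N t)^-1)).
    exact: ex_derive.
  exact: (derivableV N0 dN).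
have gK1 := gradient_snd_comp s (derivableP dK1).
have gK2 := gradient_snd_comp s (derivableP dK2).
have gN2 := gradientM (gradient_cst (-1) (s, t)) gK2.
have gi : gradient (fun w : R * R => w.1^-1) (s, t) (- s ^- 2) 0.
  have h : is_derive s 1 (@GRing.inv R) (- s ^- 2).
    by apply: is_derive_eq; [apply: is_deriveV; exact: lt0r_neq0|rewrite /GRing.scale /= mulr1].
  by have := gradient_comp1 (gradient_fst (s, t)) h; apply: gradient_eq; rewrite ?mulr0 ?mulr1.
have gP := gradientM gv gi.
have gQ := gradientD (gradientM gu gK1) (gradientM gv gN2).
eexists; eexists; eexists; split; first exact: gP.
apply: gradient_eq; last first.
- rewrite (_ : (fun w => _ - _) = (fun w => complex.Re (f (X w +i* Y w)%C) * K1 w.2 +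
                       complex.Im (f (X w +i* Y w)%C) * (-1 * K2 w.2))); last first.
    by apply/funext => w; rewrite mulN1r mulrN.
  exact: gQ.
- reflexivity.
have cs : sin t ^+ 2 = 1 - cos t ^+ 2 by rewrite -(cos2Dsin2 t); ring.
have sn0 := lt0r_neq0 s0.
rewrite /= /K1 /K2; move: N0; rewrite /N => N0.
by field: cs; rewrite N0 sn0.
Qed.

(** The integral of [Re (f e / (e - a)) dt] is the same on all the circles [a + s (e - a)],
    [0 < s <= 1]. On the largest one it is at most the right-hand side, on the small ones it
    is at least [pi * f a] up to an error, because the kernel has real part at least [1 / 2]. *)
Lemma disc_submean_pos (f : C -> C) (M : R) : r < 1 -> 0 <= M ->
  (forall z, modulus z < 1 -> exists c, cderiv f z c) -> f (a1 +i* a2)%C = M%:C%C ->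
  pi * M <= r / (r - modulus (a1 +i* a2 : C)%C) *
    \int[mu]_(t in `[0, 2 * pi]) modulus (f (circle r t)).
Proof.
move=> r1 M0 df fM; set k := r / _.
pose P (w : R * R) := complex.Im (f (X w +i* Y w)%C) * w.1^-1.
pose Q (w : R * R) := complex.Re (f (X w +i* Y w)%C) * K1 w.2 -
                      complex.Im (f (X w +i* Y w)%C) * K2 w.2.
have k0 : 0 < k by rewrite divr_gt0// subr_gt0.
have pi0 := pi_gt0 R.
have pi20 : 0 <= 2 * pi :> R by lra.
have QE w : Q w = complex.Re (f (X w +i* Y w)%C * (K1 w.2 +i* K2 w.2)%C).
  by rewrite /Q; case: (f _).
have cQ s t : 0 < s <= 1 -> {for t, continuous (fun t => Q (s, t))}.
  move=> s01; have [A [B [D [_ gQ]]]] := closed_form t r1 s01 df.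
  apply: (@continuous_comp _ _ _ (fun y : R => (s, y)) Q); last exact: gradient_continuous gQ.
  exact: (@cvg_pair _ _ _ (nbhs t) (nbhs s) (nbhs t) _ _ _ (fun=> s) id (cvg_cst _) cvg_id).
have same s : 0 < s <= 1 -> \int[mu]_(t in `[0, 2 * pi]) Q (1, t) =
                            \int[mu]_(t in `[0, 2 * pi]) Q (s, t).
  move=> /andP[s0 s1]; have := @goursat_rectangle _ P Q s 1 0 (2 * pi) s1 pi20.
  rewrite (_ : (fun x => P (x, 0) - P (x, 2 * pi)) = cst 0); last first.
    apply/funext => x; rewrite /P /X /Y /= (mulrC 2) mulr_natr cos2pi sin2pi cos0 sin0.
    by rewrite subrr.
  rewrite [X in X + _](Rintegral_itv_cst 0 s1) mul0r add0r => H.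
  apply/eqP; rewrite -subr_eq0 -Rintegral_itv_sub.
  - apply/eqP; apply: H => x y /andP[h1 h2] _; apply: closed_form => //.
    by rewrite h2 (lt_le_trans s0).
  - by apply: continuous_integrable_itv => t _; apply: cQ; rewrite ltr01 lexx.
  - by apply: continuous_integrable_itv => t _; apply: cQ; rewrite s0.
have cf t : {for t, continuous (fun t => modulus (f (circle r t)))}.
  have [|c dc] := df (circle r t); first by rewrite modulus_circle// ltW.
  exact: continuous_modulus_circle dc.
have ub : \int[mu]_(t in `[0, 2 * pi]) Q (1, t) <=
          \int[mu]_(t in `[0, 2 * pi]) (k * modulus (f (circle r t))).
  apply: le_Rintegral => //.
  - by apply: continuous_integrable_itv => t _; apply: cQ; rewrite ltr01 lexx.
  - apply: continuous_integrable_itv => t _.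
    by apply: continuousM; [exact: cst_continuous|exact: cf].
  move=> t _; rewrite QE; apply: le_trans (ler_norm _) _; apply: le_trans (Re_le_modulus _) _.
  rewrite modulusM mulrC (_ : (X (1, t) +i* Y (1, t))%C = circle r t); last first.
    by apply/eqP; rewrite eq_complex /X /Y /=; apply/andP; split; apply/eqP; ring.
  by rewrite ler_wpM2r ?modulus_ge0// modulusK.
rewrite RintegralZl// in ub; last by apply: continuous_integrable_itv => t _; exact: cf.
apply: le_trans ub.
apply/ler_addgt0Pr => e e0.
(* The circles now shrink to [a]. *)
have [c dc] : exists c, cderiv f (a1 +i* a2)%C c by apply: df; exact: lt_trans ar r1.
pose eta := e / (2 * pi * k).
have eta0 : 0 < eta by apply: divr_gt0 => //; do 2 apply: mulr_gt0 => //.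
have [d d0 hd] := cderiv_continuous dc eta0.
pose s := Num.min 1 (d / 4).
have s0 : 0 < s by rewrite lt_min ltr01 divr_gt0.
have s1 : s <= 1 by rewrite ge_min lexx.
have sd : s <= d / 4 by rewrite ge_min lexx orbT.
rewrite (same s) ?s0//.
rewrite -lerBlDr (_ : pi * M - e = (M / 2 - eta * k) * (2 * pi - 0)); last first.
  rewrite /eta; have := lt0r_neq0 pi0; move: (pi : R) => x x0.
  by field; rewrite (lt0r_neq0 k0) x0.
rewrite -Rintegral_itv_cst//; apply: le_Rintegral => //.
- by apply: continuous_integrable_itv => t _; exact: cst_continuous.
- by apply: continuous_integrable_itv => t _; apply: cQ; rewrite s0.
move=> t _; rewrite QE.
have -> : (X (s, t) +i* Y (s, t))%C = (a1 +i* a2)%C + s%:C%C * (circle r t - (a1 +i* a2)%C) :> C.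
  by apply/eqP; rewrite eq_complex /X /Y /=; apply/andP; split; apply/eqP; ring.
set h := s%:C%C * _.
have hh : modulus h < d.
  rewrite /h modulusM modulus_real gtr0_norm//.
  have h2 : modulus (circle r t - (a1 +i* a2)%C) <= 2.
    apply: le_trans (modulusB _ _) _; rewrite (modulus_circle _ (ltW r0)).
    by have := ar; move: r1; lra.
  apply: le_lt_trans (ler_wpM2l (ltW s0) h2) _.
  by move: sd d0; lra.
have := hd h hh; set D := f _ - f _ => hD.
have -> : f ((a1 +i* a2)%C + h) = M%:C%C + D by rewrite /D fM subrKC.
rewrite mulrDl.
have -> : complex.Re (M%:C%C * (K1 t +i* K2 t)%C + D * (K1 t +i* K2 t)%C) =
  M * K1 t + complex.Re (D * (K1 t +i* K2 t)%C).
  by case: D {hD} => x y /=; ring.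
have : `|complex.Re (D * (K1 t +i* K2 t)%C)| <= eta * k.
  apply: le_trans (Re_le_modulus _) _; rewrite modulusM.
  by apply: ler_pM; rewrite ?modulus_ge0 ?modulusK.
rewrite ler_norml => /andP[lb _].
have := ler_wpM2l M0 (K1_ge t).
by move: lb; lra.
Qed.

End kernel.

(** The sub-mean value property on a circle around the origin, at an arbitrary
    point [a] inside. *)
Lemma disc_submean (f : C -> C) (a : C) (r : R) : modulus a < r -> r < 1 ->
  (forall z, modulus z < 1 -> exists c, cderiv f z c) ->
  pi * modulus (f a) <= r / (r - modulus a) *
    \int[mu]_(t in `[0, 2 * pi]) modulus (f (circle r t)).
Proof.
move=> ar r1 df.
have [fa0|fa0] := eqVneq (f a) 0.
  rewrite fa0 modulus0 mulr0 mulr_ge0//.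
    by rewrite divr_ge0 ?subr_ge0 ?(ltW ar)// (le_trans (modulus_ge0 a) (ltW ar)).
  by apply: Rintegral_ge0 => t _; exact: modulus_ge0.
have m0 : 0 < modulus (f a).
  by rewrite lt_neqAle modulus_ge0 andbT; apply/eqP => /esym /modulus_eq0 /eqP; exact/negP.
(* Rotate [f] so that its value at [a] is positive. *)
pose k : C := (modulus (f a))%:C%C / f a.
have mk : modulus k = 1.
  by rewrite modulusM modulusV modulus_real gtr0_norm// divff// lt0r_neq0.
have := @disc_submean_pos r (complex.Re a) (complex.Im a) _ (fun z => k * f z) (modulus (f a))
  r1 (ltW m0).
have aE : (complex.Re a +i* complex.Im a)%C = a by case: (a).
rewrite aE => /(_ ar) H.
have -> : (fun t => modulus (f (circle r t))) = fun t => modulus (k * f (circle r t)).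
  by apply/funext => t; rewrite modulusM mk mul1r.
apply: H; last by rewrite /k divfK.
move=> z /df [c dc]; exists (k * c) => e e0; have [d d0 hd] := dc e e0.
exists d => // t td; rewrite -mulrA -!mulrBr modulusM mk mul1r.
exact: hd.
Qed.

End disc_submean.

(** * Measurability on the torus *)

Section measurable_tuple.
Variable R : realType.
Local Notation T := (measurableTypeR R).

(** A continuous function on [R^n] is measurable for the product sigma-algebra: it
    is the limit of its values at the points with coordinates rounded to
    multiples of [1 / (N + 1)], which range over a countable set. *)
Lemma measurable_continuous_tuple n (h : n.-tuple T -> R) :
  (forall s e, 0 < e -> exists2 d, 0 < d &
     forall t, (forall j, `|tnth t j - tnth s j| < d) -> `|h t - h s| <= e) ->
  measurable_fun setT h.
Proof.
move=> hc.
pose q (N : nat) (s : n.-tuple T) : n.-tuple int :=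
  [tuple Num.floor ((tnth s j : R) * N.+1%:R) | j < n].
pose v (N : nat) (k : n.-tuple int) : n.-tuple T :=
  [tuple ((tnth k j)%:~R / N.+1%:R : R) | j < n].
apply: (@measurable_fun_cvg _ _ _ setT (fun N => h \o v N \o q N)).
  move=> N _ A mA; rewrite setTI.
  have -> : (h \o v N \o q N) @^-1` A = \bigcup_(k : n.-tuple int)
      (if `[< A (h (v N k)) >] then q N @^-1` [set k] else set0).
    apply/seteqP; split => [s /= As|s [k _]].
      by exists (q N s) => //; rewrite (asboolT As).
    by case: ifPn => // /asboolP Ak /= sk; rewrite /= sk.
  apply: countable_bigcupT_measurable => // k.
  case: ifP => // _.
  have -> : q N @^-1` [set k] = \bigcap_(j in [set: 'I_n])
     ((@tnth _ T)^~ j @^-1` `[(tnth k j)%:~R / N.+1%:R, ((tnth k j) + 1)%:~R / N.+1%:R[%classic).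
    have fE j (x : R) : Num.floor (x * N.+1%:R) = tnth k j <->
       x \in `[(tnth k j)%:~R / N.+1%:R, ((tnth k j) + 1)%:~R / N.+1%:R[.
      rewrite in_itv/= ler_pdivrMr ?ltr0n// ltr_pdivlMr ?ltr0n//.
      split; first by move=> <-; exact: floor_itv.
      by move=> H; apply/eqP; rewrite floor_eq.
    apply/seteqP; split => [s /= sk j _|s sk /=].
      by rewrite /= -fE -[in RHS]sk tnth_mktuple.
    by apply: eq_from_tnth => j; rewrite tnth_mktuple; apply/fE/sk.
  apply: fin_bigcap_measurable => [|j _]; first exact: finite_finset.
  by rewrite -[X in measurable X]setTI; apply: measurable_tnth => //; exact: measurable_itv.
move=> s _; apply/cvgrPdist_le => e e0.
have [d d0 hd] := hc s e e0.
near=> N; rewrite distrC; apply: hd => j.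
rewrite !tnth_mktuple /=.
set x : R := tnth s j.
have N0 : (0 : R) < N.+1%:R by rewrite ltr0n.
have /andP[h1 h2] := floor_itv (x * N.+1%:R).
have Nd : N.+1%:R^-1 < d by near: N; exact: (near_infty_natSinv_lt (PosNum d0)).
apply: le_lt_trans Nd.
set f : R := (Num.floor _)%:~R in h1 *.
rewrite -(ler_pM2r N0) mulVf ?lt0r_neq0// -[in X in _ * X](gtr0_norm N0) -normrM.
rewrite mulrBl divfK ?lt0r_neq0//.
rewrite ler_norml; rewrite intrD in h2; rewrite -/f in h2; lra.
Unshelve. all: by end_near. Qed.

End measurable_tuple.

(** * The sub-mean value inequality in the polydisc *)

(* Simplification would expand the modulus of an explicit complex number. *)
#[local] Arguments modulus : simpl never.

Section torus_submean.
Variable R : realType.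
Local Notation C := (Cplx R).
Local Notation T := (measurableTypeR R).

(** Finitely many conditions valid for small [d > 0] are valid simultaneously for small [d]. *)
Lemma finite_small (I : eqType) (P : I -> R -> Prop) (s : seq I) :
  (forall i, i \in s -> exists2 d, 0 < d & forall d', 0 < d' -> d' <= d -> P i d') ->
  exists2 d, 0 < d & forall d', 0 < d' -> d' <= d -> forall i, i \in s -> P i d'.
Proof.
elim: s => [_|i s IH H]; first by exists 1.
have [d d0 hd] := IH (fun j js => H j (mem_behead (s := i :: s) js)).
have [e e0 he] := H i (mem_head _ _).
exists (Num.min d e) => [|d' d'0]; first by rewrite lt_min d0.
rewrite le_min => /andP[d'd d'e] j; rewrite inE => /predU1P[->|js]; first exact: he.
exact: hd.
Qed.

(** [z] with its [j]-th coordinate replaced by [t]. *)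
Definition row_upd n (z : 'rV[C]_n) j (t : C) : 'rV[C]_n :=
  \row_k (if k == j then t else z 0 k).

(** The point with first coordinate [t], followed by those of [z]. *)
Definition row_cons n (t : C) (z : 'rV[C]_n) : 'rV[C]_n.+1 :=
  \row_k oapp (z 0) t (unlift ord0 k).

Lemma row_cons0 n t (z : 'rV[C]_n) : row_cons t z 0 ord0 = t.
Proof. by rewrite mxE unlift_none. Qed.

Lemma row_consS n t (z : 'rV[C]_n) j : row_cons t z 0 (lift ord0 j) = z 0 j.
Proof. by rewrite mxE liftK. Qed.

Lemma row_consP n (P : C -> C -> Prop) t t' (z z' : 'rV[C]_n) :
  P t t' -> (forall j, P (z 0 j) (z' 0 j)) ->
  forall j, P (row_cons t z 0 j) (row_cons t' z' 0 j).
Proof.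
by move=> P0 PS j; case: (unliftP ord0 j) => [k|] ->; rewrite ?row_cons0 ?row_consS.
Qed.

(** Continuous on the polydisc and holomorphic in each variable; this weak form of
    holomorphy passes to the slices obtained by freezing a variable. *)
Definition separately_holomorphic n (F : 'rV[C]_n -> C) :=
  (forall (z : 'rV[C]_n) (e : R), @polydisc R n z -> 0 < e ->
     exists2 d : R, 0 < d & forall w : 'rV[C]_n,
       (forall j, modulus (w 0 j - z 0 j) < d) -> modulus (F w - F z) <= e) /\
  (forall (z : 'rV[C]_n) j, @polydisc R n z ->
     exists c, cderiv (fun t => F (row_upd z j t)) (z 0 j) c).

Lemma polydisc_cons n t (z : 'rV[C]_n) :
  modulus t < 1 -> @polydisc R n z -> @polydisc R n.+1 (row_cons t z).
Proof. by move=> t1 z1; exact: (row_consP (P := fun t _ => modulus t < 1) (t' := 0) (z' := 0)). Qed.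

Lemma separately_holomorphic_slice n (F : 'rV[C]_n.+1 -> C) t : modulus t < 1 ->
  separately_holomorphic F -> separately_holomorphic (fun z => F (row_cons t z)).
Proof.
move=> t1 [Fc Fd]; split=> [z e z1 e0|z j z1].
  have [d d0 hd] := Fc (row_cons t z) e (polydisc_cons t1 z1) e0.
  exists d => // w hw; apply: hd.
  by apply: (row_consP (P := fun u v => modulus (u - v) < d)) => //; rewrite subrr modulus0.
have [c dc] := Fd (row_cons t z) (lift ord0 j) (polydisc_cons t1 z1).
rewrite row_consS in dc; exists c.
rewrite (_ : (fun s => _) = (fun s => F (row_upd (row_cons t z) (lift ord0 j) s)))//.
apply/funext => s; congr F; apply/rowP => k; rewrite [RHS]mxE.
case: (unliftP ord0 k) => [l|] ->; rewrite ?row_consS ?row_cons0 ?mxE//.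
Qed.

Lemma separately_holomorphic_first n (F : 'rV[C]_n.+1 -> C) z t :
  separately_holomorphic F -> @polydisc R n z -> modulus t < 1 ->
  exists c, cderiv (fun t => F (row_cons t z)) t c.
Proof.
move=> [_ Fd] z1 t1.
have [c dc] := Fd (row_cons t z) ord0 (polydisc_cons t1 z1).
rewrite row_cons0 in dc; exists c.
rewrite (_ : (fun s => _) = (fun s => F (row_upd (row_cons t z) ord0 s)))//.
apply/funext => s; congr F; apply/rowP => k; rewrite [RHS]mxE.
by case: (unliftP ord0 k) => [l|] ->; rewrite ?row_consS ?row_cons0 ?mxE// liftK.
Qed.

Lemma polarE n r (s : n.-tuple T) j : polar r s 0 j = circle r (tnth s j).
Proof. by rewrite mxE. Qed.

Lemma polydisc_polar n r (s : n.-tuple T) : 0 <= r < 1 -> @polydisc R n (polar r s).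
Proof. by move=> /andP[r0 r1] j; rewrite polarE modulus_circle. Qed.

Lemma polar_tcons n r x (s : n.-tuple T) :
  polar r (tcons (x, s)) = row_cons (circle r x) (polar r s).
Proof.
apply/rowP => j; rewrite polarE.
case: (unliftP ord0 j) => [k|] ->; first by rewrite row_consS polarE /tcons /= tnthS.
by rewrite row_cons0 /tcons /= tnth0.
Qed.

Lemma circle_continuous (r t e : R) : 0 <= r -> 0 < e -> exists2 d, 0 < d &
  forall s, `|s - t| < d -> modulus (circle r s - circle r t) < e.
Proof.
move=> r0 e0; have e2 : 0 < e / (2 * (r + 1)) by rewrite divr_gt0// mulr_gt0//; lra.
have /cvgrPdist_lt /(_ _ e2) /nbhs_ballP [d1 /= d10 h1] := @continuous_cos R t.
have /cvgrPdist_lt /(_ _ e2) /nbhs_ballP [d2 /= d20 h2] := @continuous_sin R t.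
exists (Num.min d1 d2) => [|s]; first by rewrite lt_min d10.
rewrite lt_min distrC => /andP[s1 s2].
apply: le_lt_trans (modulus_le_ReIm _) _.
have r2 : 0 < 2 * (r + 1) by rewrite mulr_gt0//; lra.
have /= hc := h1 s s1; have /= hs := h2 s s2.
rewrite ltr_pdivlMr// in hc; rewrite ltr_pdivlMr// in hs.
rewrite /= -!mulrBr !normrM (ger0_norm r0) -(distrC (cos t)) -(distrC (sin t)).
move: hs hc; have := normr_ge0 (sin t - sin s); have := normr_ge0 (cos t - cos s).
by move: `|_| `|_| => u v; nra.
Qed.

Lemma measurable_modulus_polar n (F : 'rV[C]_n -> C) r : 0 <= r < 1 ->
  separately_holomorphic F ->
  measurable_fun setT (fun s : n.-tuple T => modulus (F (polar r s))).
Proof.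
move=> r01 [Fc _]; apply: measurable_continuous_tuple => s e e0.
have [d d0 hd] := Fc _ _ (polydisc_polar s r01) e0.
have /andP[r0 _] := r01.
have [|d' d'0 hd'] := @finite_small 'I_n (fun j d' => forall x : R, `|x - tnth s j| < d' ->
    modulus (circle r x - circle r (tnth s j)) < d) (enum 'I_n).
  move=> j _; have [d1 d10 h1] := circle_continuous (tnth s j) r0 d0.
  by exists d1 => // d2 _ d12 x hx; apply: h1; exact: lt_le_trans hx d12.
exists d' => // t ht.
have := hd (polar r t) _; set u := F _; set v := F _ => H.
have {}H : modulus (u - v) <= e.
  apply: H => j; rewrite !polarE.
  have je : j \in enum 'I_n by rewrite mem_enum.
  exact: (hd' d' d'0 (lexx _) j je).
have H1 := modulusD (u - v) v; have H2 := modulusD (v - u) u.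
rewrite !subrK -(modulusN (v - u)) opprB in H1 H2.
by rewrite ler_norml; lra.
Qed.

(** [disc_submean] in terms of the measure on the circle. *)
Lemma arc_submean (f : C -> C) (a : C) (r : R) : modulus a < r -> r < 1 ->
  (forall z, modulus z < 1 -> exists c, cderiv f z c) ->
  ((modulus (f a))%:E <= (r / (pi * (r - modulus a)))%:E *
    \int[arc_measure R]_t (modulus (f (circle r t)))%:E)%E.
Proof.
move=> ar r1 df; have r0 : 0 < r by apply: le_lt_trans ar; exact: modulus_ge0.
have ra : 0 < r - modulus a by rewrite subr_gt0.
have pi0 := pi_gt0 R.
have cf t : {for t, continuous (fun t => modulus (f (circle r t)))}.
  have [|c dc] := df (circle r t); first by rewrite modulus_circle// ltW.
  exact: continuous_modulus_circle dc.
have mf : measurable_fun [set: T] (fun t : T => modulus (f (circle r t))).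
  by apply: continuous_measurable_fun => t; exact: cf.
have := disc_submean ar r1 df.
set I := \int[_]_(_ in _) _ => H.
have IE : I%:E = (\int[lebesgue_measure]_(t in `[0%R, (2 * pi)%R]) (modulus (f (circle r t)))%:E)%E.
  rewrite /I /Rintegral fineK//.
  by apply: integrable_fin_num => //; apply: continuous_integrable_itv => t _; exact: cf.
apply: (@le_trans _ _ ((r / (pi * (r - modulus a)))%:E * I%:E)%E).
  rewrite -EFinM lee_fin -(ler_pM2l pi0); apply: le_trans H _.
  rewrite invfM (mulrCA pi) !mulrA; rewrite le_eqVlt; apply/orP; left; apply/eqP.
  move: (lt0r_neq0 pi0); move: (pi : R) => x x0.
  by field; rewrite x0 lt0r_neq0.
apply: lee_pmul => //.
- by rewrite lee_fin divr_ge0 ?(ltW r0)// mulr_ge0// ltW.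
- by rewrite lee_fin; apply: Rintegral_ge0 => t _; exact: modulus_ge0.
rewrite IE (@eq_measure_integral _ _ _ _ (arc_measure R)); last first.
  move=> A mA AD; rewrite /arc_measure /= /mfrestr /mrestr.
  by rewrite setIidl.
apply: ge0_subset_integral => //.
- exact/measurable_EFinP.
- by move=> t _; rewrite lee_fin modulus_ge0.
Qed.

(** The value at [a] is controlled by the mean modulus on the torus of radius [r];
    iterates the one variable inequality, by Tonelli's theorem. *)
Lemma torus_submean n (F : 'rV[C]_n -> C) (a : 'rV[C]_n) (r : R) : 0 <= r < 1 ->
  (forall j, modulus (a 0 j) < r) -> separately_holomorphic F ->
  ((modulus (F a))%:E <= (\prod_j (r / (pi * (r - modulus (a 0 j)))))%:E *
    \int[torus_measure R n]_s (modulus (F (polar r s)))%:E)%E.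
Proof.
move=> r01; elim: n F a => [F a _ hF|n IH F a ar hF].
  rewrite big_ord0 mul1e /= integral_dirac//; last first.
    apply/measurable_EFinP. exact: (measurable_modulus_polar r01 hF).
  by rewrite diracE mem_set// mul1e (_ : polar _ _ = a)//; apply/rowP => -[].
have /andP[r0 r1] := r01.
have [a' aE] : exists a', a = row_cons (a 0 ord0) a'.
  exists (\row_j a 0 (lift ord0 j)); apply/rowP => j.
  by case: (unliftP ord0 j) => [k|] ->; rewrite ?row_cons0 ?row_consS ?mxE.
set a0 := a 0 ord0 in aE.
have ar' j : modulus (a' 0 j) < r by have := ar (lift ord0 j); rewrite aE row_consS.
have ar0 : modulus a0 < r by exact: ar.
have a'1 : @polydisc R n a' by move=> j; exact: lt_trans (ar' j) r1.
have k0 (b : C) : modulus b < r -> 0 <= r / (pi * (r - modulus b)).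
  by move=> br; rewrite divr_ge0// mulr_ge0 ?pi_ge0// subr_ge0 ltW.
have mF := measurable_modulus_polar r01 hF.
pose G (x : T * n.-tuple T) := (modulus (F (polar r (tcons x))))%:E.
have mG : measurable_fun setT G.
  apply/measurable_EFinP; apply: (measurableT_comp mF); exact: measurable_tcons.
have G0 x : (0 <= G x)%E by rewrite lee_fin modulus_ge0.
have -> : (\int[torus_measure R n.+1]_s (modulus (F (polar r s)))%:E =
    \int[arc_measure R]_x \int[torus_measure R n]_s G (x, s))%E.
  rewrite /= /torus_step ge0_integral_pushforward//.
  - rewrite preimage_setT.
    exact: (@fubini_tonelli1 _ _ _ _ _ (arc_measure R) (torus_measure R n) G).
  - exact: measurable_tcons.
  - exact/measurable_EFinP.
  - by move=> s _; rewrite lee_fin modulus_ge0.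
rewrite big_ord_recl -/a0 EFinM -muleA.
have df z : modulus z < 1 -> exists c, cderiv (fun t => F (row_cons t a')) z c.
  by move=> z1; exact: separately_holomorphic_first.
have /= h1 := arc_submean ar0 r1 df; rewrite -aE in h1.
apply: le_trans h1 _; apply: lee_wpmul2l; first by rewrite lee_fin k0.
have -> : \prod_(j < n) (r / (pi * (r - modulus (a 0 (lift ord0 j))))) =
    \prod_(j < n) (r / (pi * (r - modulus (a' 0 j)))).
  by apply: eq_bigr => j _; rewrite aE row_consS.
rewrite -ge0_integralZl//; last 3 first.
- exact: (@measurable_fun_fubini_tonelli_F _ _ _ _ _ (torus_measure R n) G).
- by move=> x _; exact: integral_ge0.
- by rewrite lee_fin prodr_ge0// => j _; exact: k0.
apply: ge0_le_integral => //.
- by move=> x _; rewrite lee_fin modulus_ge0.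
- apply/measurable_EFinP; apply: continuous_measurable_fun => t.
  have [|c dc] := df (circle r t); first by rewrite modulus_circle.
  exact: (continuous_modulus_circle dc).
- apply: measurable_funeM.
  exact: (@measurable_fun_fubini_tonelli_F _ _ _ _ _ (torus_measure R n) G).
move=> x _.
have hFx : separately_holomorphic (fun z => F (row_cons (circle r x) z)).
  by apply: separately_holomorphic_slice => //; rewrite modulus_circle.
apply: le_trans (IH _ _ ar' hFx) _; rewrite /G.
by under [in leRHS]eq_integral do rewrite polar_tcons.
Qed.

End torus_submean.

(** * Holomorphic functions and weights *)

Section holomorphic_submean.
Variable R : realType.
Local Notation C := (Cplx R).

Lemma Cplx_gt0 (e : C) : 0 < e -> exists2 d : R, 0 < d & e = d%:C%C.
Proof.
by case: e => x y; rewrite ltcE /= => /andP[/eqP -> x0]; exists x.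
Qed.

Lemma normr_lt_real (z : C) (d : R) : (`|z| < d%:C%C) = (modulus z < d).
Proof. by rewrite modulusE ltcR. Qed.

Lemma normr_le_real (z : C) (d : R) : (`|z| <= d%:C%C) = (modulus z <= d).
Proof. by rewrite modulusE lecR. Qed.

Lemma holomorphic_separately n (F : 'rV[C]_n -> C) :
  holomorphic F -> separately_holomorphic F.
Proof.
move=> hF; split=> [z e z1 e0|z j z1].
  have /cvgrPdist_le := differentiable_continuous (hF z z1).
  have e0' : (0 : C) < e%:C%C by rewrite ltcR.
  move=> /(_ _ e0') /nbhs_ballP [d /= /Cplx_gt0 [d' d'0 ->] hd].
  exists d' => // w hw; rewrite -normr_le_real distrC; apply: hd.
  split=> [|i k]; first by rewrite ltcR.
  by rewrite (ord1 i) -ball_normE /ball_ /= normr_lt_real -modulusN opprB; exact: hw.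
pose v : 'rV[C]_n := delta_mx 0 j.
have dF : derivable F z v by apply: diff_derivable; exact: hF.
exists ('D_v F z) => e e0.
have /cvgrPdist_le : (fun h => h^-1 *: ((F \o shift z) (h *: v) - F z)) @ 0^' --> 'D_v F z.
  by exact: dF.
have e0' : (0 : C) < e%:C%C by rewrite ltcR.
move=> /(_ _ e0') /nbhs_ballP [d /= /Cplx_gt0 [d' d'0 ->] hd].
exists d' => // t td.
have E s : row_upd z j (z 0 j + s) = s *: v + z.
  apply/rowP => k; rewrite !mxE eqxx/=.
  by case: eqVneq => [->|_]; rewrite ?mulr1 ?mulr0 ?add0r// addrC.
rewrite E -[z 0 j]addr0 E scale0r add0r.
have [->|t0] := eqVneq t 0.
  by rewrite scale0r add0r subrr mulr0 subr0 modulus0 mulr0.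
have := hd t; rewrite -ball_normE /ball_ /= sub0r normrN normr_lt_real => /(_ td t0).
rewrite normr_le_real => H.
have mt : 0 < modulus t.
  by rewrite lt_neqAle modulus_ge0 andbT; apply/eqP => /esym /modulus_eq0 /eqP; exact/negP.
rewrite -(ler_pM2r mt) -modulusM in H.
rewrite -modulusN; apply: le_trans H.
rewrite le_eqVlt; apply/orP; left; apply/eqP; congr modulus.
rewrite mulrBl opprB; congr (_ - _).
by rewrite /GRing.scale /= mulrAC mulVf// mul1r.
Qed.

(** Up to the factor [4 ^ n], the weight of [a] absorbs the kernel of the sub-mean value
    inequality at [a], once the radius is close to [1]. A single radius serves all the points of a
    finite set. *)
Lemma weighted_submean n (A : seq 'rV[C]_n) : (forall a, a \in A -> @polydisc R n a) ->
  exists2 r : R, 0 <= r < 1 & forall a F, a \in A -> holomorphic F ->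
    ((weight a * modulus (F a))%:E <= (4 ^+ n)%:E *
      \int[torus_measure R n]_s (modulus (F (polar r s)))%:E)%E.
Proof.
move=> A1.
have [|d d0 hd] := @finite_small _ 'rV[C]_n (fun a d => forall j, d <= (1 - modulus (a 0 j)) / 2) A.
  move=> a /A1 a1.
  have [|d d0 hd] := @finite_small _ 'I_n (fun j d => d <= (1 - modulus (a 0 j)) / 2) (enum 'I_n).
    move=> j _; exists ((1 - modulus (a 0 j)) / 2) => //.
    by have := a1 j; lra.
  exists d => // d' d'0 dd' j.
  by apply: le_trans dd' _; apply: hd; rewrite ?mem_enum.
pose d' := Num.min d (1 / 2).
have d'0 : 0 < d' by rewrite lt_min d0; lra.
have dd' : d' <= d by rewrite ge_min lexx.
have d'2 : d' <= 1 / 2 by rewrite ge_min lexx orbT.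
exists (1 - d'); first by lra.
move=> a F aA hF; have a1 := A1 a aA.
have hd' := hd d' d'0 dd' a aA.
have ar j : modulus (a 0 j) < 1 - d' by have := hd' j; have := a1 j; lra.
have := torus_submean _ ar (holomorphic_separately hF).
have -> : 0 <= 1 - d' < 1 by lra.
move=> /(_ isT); set I := (\int[_]_ _ _)%E => H.
have w0 : 0 <= weight a.
  apply: prodr_ge0 => j _; rewrite subr_ge0 expr_le1//; last exact: modulus_ge0.
  exact: ltW (a1 j).
rewrite EFinM; apply: le_trans (lee_wpmul2l _ H) _; first by rewrite lee_fin.
rewrite muleA -EFinM; apply: lee_wpmul2r.
  by apply: integral_ge0 => s _; rewrite lee_fin modulus_ge0.
rewrite lee_fin /weight -big_split /=.
have -> : (4 : R) ^+ n = \prod_(j < n) 4 by rewrite prodr_const card_ord.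
apply: ler_prod => j _.
have := hd' j; have := a1 j; have := ar j; have := modulus_ge0 (a 0 j).
have := pi_ge2 R; move: (modulus _) (pi : R) => m x x2 m0 mr m1 hm.
have p0 : 0 < x * (1 - d' - m) by rewrite mulr_gt0//; lra.
apply/andP; split.
  rewrite mulr_ge0 ?divr_ge0 ?(ltW p0)//; last by lra.
  by rewrite subr_ge0 expr_le1//; lra.
rewrite mulrA ler_pdivrMr//.
have h1 : 2 * ((1 - m) / 2) <= x * (1 - d' - m) by apply: ler_pM => //; lra.
have h2 : 0 <= (1 - m) * (1 + m) by rewrite mulr_ge0//; lra.
have h3 : 0 <= (1 - m) * (1 - m) by rewrite mulr_ge0//; lra.
have h4 : 0 <= (1 - m) * (1 + m) * d' by rewrite mulr_ge0// ltW.
have -> : (1 - m ^+ 2) * (1 - d') = (1 - m) * (1 + m) - (1 - m) * (1 + m) * d' by ring.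
lra.
Qed.

End holomorphic_submean.

(** * Elementary properties of Hardy spaces *)

Section hardy_space.
Variables (R : realType) (n : nat) (p : R).
Hypothesis p0 : 0 < p.
Local Notation C := (Cplx R).
Implicit Types (f g : 'rV[C]_n -> C) (S : set 'rV[C]_n).

Lemma hardy_norm_pow_ge0 q f : (0 <= hardy_norm_pow q f)%E.
Proof.
apply: le_trans (ereal_sup_ubound _); last first.
  by exists 0 => //; rewrite /= in_itv /= lexx ltr01.
by apply: integral_ge0 => s _; rewrite lee_fin powR_ge0.
Qed.

Lemma le_hardy_norm_pow q f r : 0 <= r < 1 ->
  (\int[torus_measure R n]_s (modulus (f (polar r s)) `^ q)%:E <= hardy_norm_pow q f)%E.
Proof. by move=> r01; apply: ereal_sup_ubound; exists r => //=; rewrite in_itv. Qed.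

Lemma hardy_norm_pow_le q f K :
  (forall r, 0 <= r < 1 ->
     (\int[torus_measure R n]_s (modulus (f (polar r s)) `^ q)%:E <= K)%E) ->
  (hardy_norm_pow q f <= K)%E.
Proof. by move=> H; apply: ge_ereal_sup => _ [r /= rI <-]; apply: H; rewrite in_itv in rI. Qed.

Lemma measurable_modulus_pow q f r : 0 <= r < 1 -> holomorphic f ->
  measurable_fun setT (fun s : n.-tuple (measurableTypeR R) => (modulus (f (polar r s)) `^ q)%:E).
Proof.
move=> r01 hf; apply/measurable_EFinP.
apply: (measurableT_comp (measurable_powR q)).
exact: measurable_modulus_polar (holomorphic_separately hf).
Qed.

Lemma hardy0 : hardy p (fun _ : 'rV[C]_n => 0 : C) /\
  hardy_norm_pow p (fun _ : 'rV[C]_n => 0 : C) = 0%E.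
Proof.
have H0 : hardy_norm_pow p (fun _ : 'rV[C]_n => 0 : C) = 0%E.
  apply/eqP; rewrite eq_le hardy_norm_pow_ge0 andbT; apply: hardy_norm_pow_le => r r01.
  rewrite integral0_eq// => s _; by rewrite modulus0 powR0 ?lt0r_neq0.
split; last exact: H0.
split; last by rewrite H0.
by move=> z _; exact: differentiable_cst.
Qed.

Lemma powR_add_le (x y : R) : 0 <= x -> 0 <= y ->
  (x + y) `^ p <= 2 `^ p * (x `^ p + y `^ p).
Proof.
move=> x0 y0.
wlog xy : x y x0 y0 / x <= y => [H|].
  have [/H|/ltW /H] := leP x y; first exact.
  by rewrite addrC [X in _ * X]addrC; exact.
apply: (@le_trans _ _ ((2 * y) `^ p)).
  by apply: ge0_ler_powR; rewrite ?nnegrE ?(ltW p0)//; lra.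
by rewrite powRM// ler_wpM2l ?powR_ge0// lerDr powR_ge0.
Qed.

Lemma hardyD f g : hardy p f -> hardy p g -> hardy p (fun z => (f z + g z)%R) /\
  (hardy_norm_pow p (fun z => (f z + g z)%R) <=
     (2 `^ p)%:E * (hardy_norm_pow p f + hardy_norm_pow p g))%E.
Proof.
move=> [hf ff] [hg fg].
have le : (hardy_norm_pow p (fun z => (f z + g z)%R) <=
     (2 `^ p)%:E * (hardy_norm_pow p f + hardy_norm_pow p g))%E.
  apply: hardy_norm_pow_le => r r01.
  have mf := measurable_modulus_pow p r01 hf.
  have mg := measurable_modulus_pow p r01 hg.
  apply: (@le_trans _ _ (\int[torus_measure R n]_s ((2 `^ p)%:E *
     ((modulus (f (polar r s)) `^ p)%:E + (modulus (g (polar r s)) `^ p)%:E)))%E).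
    apply: ge0_le_integral => //.
    - by move=> s _; rewrite lee_fin powR_ge0.
    - apply: (measurable_modulus_pow (f := fun z => (f z + g z)%R) p r01) => z z1.
      exact: (differentiableD (hf z z1) (hg z z1)).
    - by apply: measurable_funeM; exact: emeasurable_funD.
    move=> s _; rewrite -EFinD -EFinM lee_fin.
    apply: le_trans (powR_add_le (modulus_ge0 _) (modulus_ge0 _)).
    apply: ge0_ler_powR; rewrite ?nnegrE ?modulus_ge0 ?(ltW p0)//.
      by rewrite addr_ge0 ?modulus_ge0.
    exact: modulusD.
  rewrite ge0_integralZl//; last 2 first.
  - exact: emeasurable_funD.
  - by move=> s _; rewrite adde_ge0// lee_fin powR_ge0.
  apply: lee_wpmul2l; first by rewrite lee_fin powR_ge0.
  rewrite ge0_integralD//; [|by move=> s _; rewrite lee_fin powR_ge0..].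
  by apply: leeD; exact: le_hardy_norm_pow.
split; last exact: le.
split; first by move=> z z1; exact: (differentiableD (hf z z1) (hg z z1)).
apply: le_lt_trans le _.
apply: lte_mul_pinfty.
- by rewrite lee_fin powR_ge0.
- by rewrite fin_numElt ltNyr ltry.
- exact: (lte_add_pinfty ff fg).
Qed.

Lemma hardyZ (c : C) f : hardy p f -> hardy p (fun z => (c * f z)%R) /\
  (hardy_norm_pow p (fun z => (c * f z)%R) <= (modulus c `^ p)%:E * hardy_norm_pow p f)%E.
Proof.
move=> [hf ff].
have le : (hardy_norm_pow p (fun z => (c * f z)%R) <= (modulus c `^ p)%:E * hardy_norm_pow p f)%E.
  apply: hardy_norm_pow_le => r r01.
  under eq_integral do rewrite modulusM powRM ?modulus_ge0// EFinM.
  rewrite ge0_integralZl//.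
  - by apply: lee_wpmul2l; [rewrite lee_fin powR_ge0|exact: le_hardy_norm_pow].
  - exact: measurable_modulus_pow.
  - by move=> s _; rewrite lee_fin powR_ge0.
  - by rewrite lee_fin powR_ge0.
split; last exact: le.
split.
  by move=> z z1; exact: (differentiableM (differentiable_cst c z) (hf z z1)).
apply: le_lt_trans le _.
by apply: lte_mul_pinfty; [rewrite lee_fin powR_ge0|rewrite fin_numElt ltNyr ltry|exact: ff].
Qed.

Lemma restrictionD f g a : restriction p (fun z => (f z + g z)%R) a =
  restriction p f a + restriction p g a.
Proof. exact: mulrDr. Qed.

Lemma restrictionZ (c : C) f a : restriction p (fun z => (c * f z)%R) a = c * restriction p f a.
Proof. exact: mulrCA. Qed.

(** A sum of nonnegative terms is bounded by a bound of its finite partial sums. *)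
Lemma esum_le_seq S (u : 'rV[C]_n -> R) (M : R) : (forall a, 0 <= u a) ->
  (forall X : seq 'rV[C]_n, uniq X -> (forall a, a \in X -> S a) -> \sum_(a <- X) u a <= M) ->
  (\esum_(a in S) (u a)%:E <= M%:E)%E.
Proof.
move=> u0 H; apply: ge_ereal_sup => _ [X [fX XS] <-].
rewrite fsbig_finite// sumEFin lee_fin; apply: H; first exact: finmap.fset_uniq.
by move=> a; rewrite in_fset_set // => /set_mem; exact: XS.
Qed.

Lemma ell_of_bounded S (u : 'rV[C]_n -> C) (M : R) :
  (forall X : seq 'rV[C]_n, uniq X -> (forall a, a \in X -> S a) ->
     \sum_(a <- X) modulus (u a) `^ p <= M) -> ell S p u.
Proof.
move=> H; rewrite /ell /= /ell_norm; apply: poweR_lty.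
apply: (@le_lt_trans _ _ M%:E); last exact: ltry.
by apply: esum_le_seq => // a; exact: powR_ge0.
Qed.

End hardy_space.

(** * The constant of interpolation *)

Section uniform_interpolation.
Variables (R : realType) (n : nat) (p : R) (S : set 'rV[Cplx R]_n).
Hypotheses (p0 : 0 < p) (intS : interpolating p S).
Local Notation C := (Cplx R).
Local Notation H := (hardy_norm_pow p).
Implicit Types (f g : 'rV[C]_n -> C) (A B : seq 'rV[C]_n) (u v w : 'rV[C]_n -> C).

Lemma ler_sum_support (I : eqType) (X Y : seq I) (F : I -> R) : uniq X ->
  (forall i, 0 <= F i) -> (forall i, i \in X -> i \notin Y -> F i = 0) ->
  \sum_(i <- X) F i <= \sum_(i <- Y) F i.
Proof.
move=> + F0; elim: X Y => [|x X IH] Y /=; first by rewrite big_nil sumr_ge0.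
move=> /andP[xX uX] XY; rewrite big_cons.
have [xY|xY] := boolP (x \in Y).
  rewrite (big_rem x xY) /= lerD2l; apply: IH => // i iX iY.
  apply: XY; first by rewrite inE iX orbT.
  rewrite (perm_mem (perm_to_rem xY)) inE negb_or iY andbT.
  by apply: contraNN xX => /eqP <-.
rewrite XY ?mem_head// add0r; apply: IH => // i iX iY.
by apply: XY => //; rewrite inE iX orbT.
Qed.

Lemma interpolate_finite_support B v : uniq B ->
  exists2 f, hardy p f & forall a, S a -> restriction p f a = if a \in B then v a else 0.
Proof.
move=> uB; apply: intS; apply: (@ell_of_bounded _ _ _ _ _ (\sum_(b <- B) modulus (v b) `^ p)).
move=> X uX _.
rewrite [leRHS](eq_big_seq (fun a => modulus (if a \in B then v a else 0) `^ p)).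
  apply: ler_sum_support => // [i|i _ /negbTE ->]; first exact: powR_ge0.
  by rewrite modulus0 powR0 ?lt0r_neq0.
by move=> b bB; rewrite /= bB.
Qed.

(** Families supported in a fixed finite set [B] are interpolated on the whole of [S], with
    bounds depending on [B]. *)
Lemma interpolate_finite_support_bounded B (t : R) : uniq B -> 0 <= t ->
  exists2 K : R, 0 <= K & forall v, (forall b, b \in B -> modulus (v b) `^ p <= t) ->
    exists f, [/\ hardy p f, forall a, S a -> restriction p f a = (if a \in B then v a else 0) &
                  (H f <= K%:E)%E].
Proof.
move=> + t0; elim: B => [_|b B IH /= /andP[bB uB]].
  exists 0 => // v _; exists (fun=> 0); have [h0 ->] := hardy0 n p0.
  by split=> // a _; rewrite /restriction mulr0.
have [K K0 hK] := IH uB.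
have [g hg gE] := @interpolate_finite_support [:: b] (fun=> 1) isT.
pose G := fine (H g).
have GE : G%:E = H g.
  by rewrite /G fineK// ge0_fin_numE ?hardy_norm_pow_ge0//; case: hg.
have G0 : 0 <= G by rewrite -lee_fin GE hardy_norm_pow_ge0.
exists (2 `^ p * (K + t * G)) => [|v hv].
  by rewrite mulr_ge0 ?powR_ge0// addr_ge0// mulr_ge0.
have [|f [hf fE fK]] := hK v; first by move=> a aB; apply: hv; rewrite inE aB orbT.
have [hz zK] := hardyZ (v b) hg.
have [hs sK] := hardyD p0 hf hz.
exists (fun z => f z + v b * g z); split=> // [a Sa|].
  rewrite restrictionD restrictionZ fE// gE// !inE.
  have [->|ab] /= := eqVneq a b; first by rewrite (negbTE bB) add0r mulr1.
  by rewrite mulr0 addr0.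
apply: le_trans sK _; rewrite EFinM; apply: lee_wpmul2l; first by rewrite lee_fin powR_ge0.
rewrite EFinD; apply: leeD => //; apply: le_trans zK _.
rewrite -GE -EFinM lee_fin; apply: ler_wpM2r => //.
by apply: hv; exact: mem_head.
Qed.

(** Every family on a finite subset [A] of [S] is interpolated on [A] by a function whose norm, to
    the power [p], is at most [K] times that of the family. *)
Definition interpolates_with (K : R) := forall A v, uniq A -> (forall a, a \in A -> S a) ->
  exists f, [/\ hardy p f, forall a, a \in A -> restriction p f a = v a &
                (H f <= (K * \sum_(a <- A) modulus (v a) `^ p)%:E)%E].

(** By homogeneity, the failing families can be taken arbitrarily small, and their interpolating
    functions arbitrarily large. *)
Lemma not_interpolates_with : (forall K, 0 < K -> ~ interpolates_with K) ->
  forall K t : R, 0 < K -> 0 < t -> exists A v,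
    [/\ uniq A, forall a, a \in A -> S a, \sum_(a <- A) modulus (v a) `^ p <= t &
      forall f, hardy p f -> (forall a, a \in A -> restriction p f a = v a) -> (K%:E < H f)%E].
Proof.
move=> nint K t K0 t0.
have [A [v [uA AS hv]]] : exists A v, [/\ uniq A, forall a, a \in A -> S a &
    forall f, hardy p f -> (forall a, a \in A -> restriction p f a = v a) ->
      ((K / t * \sum_(a <- A) modulus (v a) `^ p)%:E < H f)%E].
  apply: contrapT => hn; apply: (nint (K / t)); first by rewrite divr_gt0.
  move=> A v uA AS; apply: contrapT => hAv; apply: hn; exists A, v; split=> // f hf fE.
  by rewrite ltNge; apply/negP => fK; apply: hAv; exists f.
set sg := \sum_(a <- A) _ in hv.
have sg0 : 0 <= sg by apply: sumr_ge0 => a _; exact: powR_ge0.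
have {}sg0 : 0 < sg.
  rewrite lt_neqAle sg0 andbT eq_sym; apply/eqP => sg0'.
  have [h0 H0] := hardy0 n p0.
  have v0 a : a \in A -> v a = 0.
    move=> aA; apply: modulus_eq0; apply: contrapT => /eqP m0.
    have : 0 < modulus (v a) `^ p by rewrite powR_gt0// lt_neqAle eq_sym m0 modulus_ge0.
    rewrite ltNge => /negP; apply.
    rewrite -sg0' /sg (big_rem a aA) /= lerDl sumr_ge0// => b _; exact: powR_ge0.
  have := hv _ h0; rewrite H0 sg0' mulr0 ltxx => hF; apply: notF; apply: hF => a aA.
  by rewrite /restriction mulr0 v0.
pose s := (t / sg) `^ p^-1.
have s0 : 0 < s by rewrite powR_gt0// divr_gt0.
have sp : s `^ p = t / sg.
  by rewrite -powRrM mulVf ?lt0r_neq0// powRr1// divr_ge0// ltW.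
exists A, (fun a => s%:C%C * v a); split=> //.
  under eq_bigr do rewrite modulusM modulus_real gtr0_norm// powRM ?modulus_ge0 ?(ltW s0)// sp.
  by rewrite -mulr_sumr -/sg divfK// lt0r_neq0.
move=> f hf fE.
have [hz zH] := hardyZ (s^-1)%:C%C hf.
have := hv _ hz; move=> /(_ _)/lt_le_trans => /(_ _ _ zH) hh.
have {}hh : ((K / t * sg)%:E < (modulus (s^-1)%:C%C `^ p)%:E * H f)%E.
  apply: hh => a aA; rewrite restrictionZ fE// mulrA.
  by rewrite -rmorphM /= mulVf ?lt0r_neq0// mul1r.
have s'p : modulus ((s^-1)%:C%C : C) `^ p = sg / t.
  rewrite modulus_real gtr0_norm ?invr_gt0// -powR_inv1 ?(ltW s0)// -powRrM mulN1r.
  by rewrite powRN sp invf_div.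
rewrite s'p in hh.
have ts : 0 < t / sg by rewrite divr_gt0.
rewrite -(@lte_pmul2l _ (t / sg)%:E) in hh; rewrite ?lte_fin//.
rewrite muleA -!EFinM in hh.
have e1 : t / sg * (K / t * sg) = K by field; rewrite !lt0r_neq0.
have e2 : t / sg * (sg / t) = 1 by field; rewrite !lt0r_neq0.
by rewrite e1 e2 mul1e in hh.
Qed.

(** One step of a gliding hump: the family [v] on [B] is extended beyond [B] by a small piece that
    forces the norm of all interpolating functions above [M]. From an interpolating function [f] of
    the extension, [f - g + e] interpolates the large piece [w] on [A], where [g] interpolates [v]
    and [e] the part of [w] lying in [B]. *)
Lemma gliding_hump_step : (forall K, 0 < K -> ~ interpolates_with K) ->
  forall B v (M t : R), uniq B -> (forall a, a \in B -> S a) -> 0 < M -> 0 < t ->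
  exists B' v', [/\ uniq B', forall a, a \in B' -> S a,
    forall a, a \in B -> a \in B' /\ v' a = v a,
    \sum_(a <- B') modulus (v' a) `^ p <= \sum_(a <- B) modulus (v a) `^ p + t &
    forall f, hardy p f -> (forall a, a \in B' -> restriction p f a = v' a) -> (M%:E < H f)%E].
Proof.
move=> nint B v M t uB BS M0 t0.
have [g hg gE] := interpolate_finite_support v uB.
pose G := fine (H g).
have GE : G%:E = H g.
  by rewrite /G fineK// ge0_fin_numE ?hardy_norm_pow_ge0//; case: hg.
have G0 : 0 <= G by rewrite -lee_fin GE hardy_norm_pow_ge0.
have [K K0 hK] := interpolate_finite_support_bounded uB (ltW t0).
have q0 : 0 < 2 `^ p :> R by rewrite powR_gt0.
pose c : C := (-1)%:C%C.
have mc : modulus c `^ p = 1 by rewrite modulus_real normrN1 powR1.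
have L0 : 0 < 2 `^ p * (2 `^ p * (M + G) + K).
  by rewrite mulr_gt0// ltr_pwDl// mulr_gt0// ltr_pwDl.
have [A [w [uA AS wt hw]]] := not_interpolates_with nint L0 t0.
pose v' a := if a \in B then v a else w a.
exists (undup (B ++ A)), v'; split.
- exact: undup_uniq.
- by move=> a; rewrite mem_undup mem_cat => /orP[/BS|/AS].
- by move=> a aB; rewrite mem_undup mem_cat aB /v' aB.
- apply: (@le_trans _ _ (\sum_(a <- B ++ [seq a <- A | a \notin B]) modulus (v' a) `^ p)).
    apply: ler_sum_support; first exact: undup_uniq.
      by move=> a; exact: powR_ge0.
    move=> a; rewrite mem_undup !mem_cat mem_filter.
    by case: (a \in B) => //= ->.
  rewrite big_cat /=; apply: lerD.
    by rewrite le_eqVlt; apply/orP; left; apply/eqP; apply: eq_big_seq => a aB; rewrite /v' aB.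
  apply: le_trans wt; rewrite big_filter.
  rewrite [leRHS](bigID (fun a => a \notin B)) /= -[leLHS]addr0; apply: lerD.
    by rewrite le_eqVlt; apply/orP; left; apply/eqP; apply: eq_bigr => a /negbTE aB; rewrite /v' aB.
  by apply: sumr_ge0 => a _; exact: powR_ge0.
move=> f hf fE; rewrite ltNge; apply/negP => fM.
have [|e [he eE eK]] := hK (fun a => if a \in A then w a else 0).
  move=> b _; case: ifP => [bA|_]; last by rewrite modulus0 powR0 ?lt0r_neq0// ltW.
  apply: le_trans wt; rewrite (big_rem b bA) /= lerDl.
  by apply: sumr_ge0 => a _; exact: powR_ge0.
have [hcg cgH] := hardyZ c hg; rewrite mc mul1e -GE in cgH.
have [h1 h1H] := hardyD p0 hf hcg.
have [h2 h2H] := hardyD p0 h1 he.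
have : (forall a, a \in A -> restriction p (fun z => (f z + c * g z) + e z) a = w a).
  move=> a aA; rewrite !restrictionD restrictionZ fE; last by rewrite mem_undup mem_cat aA orbT.
  rewrite gE ?eE; [|exact: AS|exact: AS]; rewrite /v' /c.
  case: ifP => aB; last by rewrite mulr0 !addr0.
  by rewrite aA rmorphN rmorph1 mulN1r subrr add0r.
move=> /(hw _ h2); rewrite ltNge => /negP; apply.
apply: le_trans h2H _; rewrite EFinM; apply: lee_wpmul2l; first by rewrite lee_fin ltW.
rewrite EFinD; apply: leeD => //; apply: le_trans h1H _.
rewrite EFinM; apply: lee_wpmul2l; first by rewrite lee_fin ltW.
by rewrite EFinD; apply: leeD.
Qed.

(** The constant of interpolation. If there is none, iterating [gliding_hump_step] gives a family
    of [l^p] whose interpolating functions all have infinite norm. *)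
Lemma interpolating_uniform : exists2 K : R, 0 < K & interpolates_with K.
Proof.
apply: contrapT => nex.
have nint K : 0 < K -> ~ interpolates_with K by move=> K0 hK; apply: nex; exists K.
pose ok (s : nat * (seq 'rV[C]_n * ('rV[C]_n -> C))) :=
  uniq s.2.1 /\ forall a, a \in s.2.1 -> S a.
pose next (s s' : {s | ok s}) := let: (k, (B, v)) := sval s in let: (k', (B', v')) := sval s' in
  [/\ k' = k.+1, forall a, a \in B -> a \in B' /\ v' a = v a,
    \sum_(a <- B') modulus (v' a) `^ p <= \sum_(a <- B) modulus (v a) `^ p + 1 / 2 ^+ k' &
    forall f, hardy p f -> (forall a, a \in B' -> restriction p f a = v' a) -> (k'%:R%:E < H f)%E].
have ok0 : ok (0%N, ([::], fun=> 0)) by split.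
have [F [F0 FS]] : exists F : nat -> {s | ok s},
    F 0%N = exist _ _ ok0 /\ forall k, next (F k) (F k.+1).
  have [|F [F0 FS]] := @dependent_choice _ next _ (exist _ _ ok0); last by exists F.
  move=> s; apply/cid; case: s => [[k [B v]] [/= uB BS]].
  have k0 : 0 < k.+1%:R :> R by rewrite ltr0n.
  have t0 : 0 < 1 / 2 ^+ k.+1 :> R by rewrite divr_gt0// exprn_gt0.
  have [B' [v' [uB' BS' ext le' h']]] := gliding_hump_step nint v uB BS k0 t0.
  by exists (exist _ (k.+1, (B', v')) (conj uB' BS')).
pose B k := (sval (F k)).2.1; pose v k := (sval (F k)).2.2.
have Fk k : (sval (F k)).1 = k.
  elim: k => [|k IH]; first by rewrite F0.
  have := FS k; rewrite /next; case: (sval (F k)) IH => j [? ?] /= ->.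
  by case: (sval (F k.+1)) => j' [? ?] [].
have step k : [/\ forall a, a \in B k -> a \in B k.+1 /\ v k.+1 a = v k a,
    \sum_(a <- B k.+1) modulus (v k.+1 a) `^ p <=
      \sum_(a <- B k) modulus (v k a) `^ p + 1 / 2 ^+ k.+1 &
    forall f, hardy p f -> (forall a, a \in B k.+1 -> restriction p f a = v k.+1 a) ->
      (k.+1%:R%:E < H f)%E].
  have := FS k; rewrite /next /B /v; have := Fk k; have := Fk k.+1.
  by case: (sval (F k)) => j [b w]; case: (sval (F k.+1)) => j' [b' w'] /= -> -> [_].
have ext k m a : a \in B k -> a \in B (k + m)%N /\ v (k + m)%N a = v k a.
  move=> aB; elim: m => [|m [IH1 IH2]]; first by rewrite addn0.
  by rewrite addnS; have [/(_ a IH1) [-> ->] _ _] := step (k + m)%N.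
have sum k : \sum_(a <- B k) modulus (v k a) `^ p <= 1 - 1 / 2 ^+ k.
  elim: k => [|k IH]; first by rewrite /B F0 /= big_nil expr0 divr1 subrr.
  have [_ h _] := step k; apply: le_trans h _.
  have -> : 1 - 1 / 2 ^+ k.+1 = (1 - 1 / 2 ^+ k) + 1 / 2 ^+ k.+1 :> R.
    by rewrite exprS; field; rewrite expf_neq0.
  by rewrite lerD2r.
(* [u] is the common extension of the families [v k], by zero elsewhere. *)
have ex a : exists x : C, (forall k, a \in B k -> v k a = x) /\ ((forall k, a \notin B k) -> x = 0).
  have [[k ak]|na] := pselect (exists k, a \in B k); last first.
    by exists 0; split=> // k ak; exfalso; apply: na; exists k.
  exists (v k a); split=> [l al|/(_ k)]; last by rewrite ak.
  by have [_ <-] := ext k l a ak; have [_ <-] := ext l k a al; rewrite addnC.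
have [u hu] := choice ex.
have [|f hf fE] := @intS u.
  apply: (@ell_of_bounded _ _ _ _ _ 1) => X uX XS.
  have [k hk] : exists k, forall a, a \in X -> a \notin B k -> u a = 0.
    elim: X {uX XS} => [|x X [k hk]]; first by exists 0%N.
    have [[l xl]|nx] := pselect (exists l, x \in B l).
      exists (k + l)%N => a; rewrite inE => /predU1P[->|aX] aB.
        by have [xkl _] := ext l k x xl; rewrite addnC xkl in aB.
      apply: hk => //; apply: contraNN aB => aBk.
      by have [] := ext k l a aBk.
    exists k => a; rewrite inE => /predU1P[->|aX] aB; last exact: hk.
    have [_ ux0] := hu x; apply: ux0 => l; apply/negP => xl; apply: nx; exists l; exact: xl.
  have := @ler_sum_support _ X (B k) (fun a => modulus (u a) `^ p) uX.
  move=> /(_ (fun _ => powR_ge0 _ _)) le.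
  apply: (le_trans (le _)).
    by move=> a aX aB; rewrite (hk a aX aB) modulus0 powR0 ?lt0r_neq0.
  rewrite (eq_big_seq (fun a => modulus (v k a) `^ p)); last first.
    by move=> a aB; have [h _] := hu a; rewrite /= (h k aB).
  apply: le_trans (sum k) _.
  by rewrite gerBl divr_ge0// exprn_ge0.
have big k : (k.+1%:R%:E < H f)%E.
  have [_ _ h] := step k; apply: h => // a aB.
  have Sa : S a by have [_ +] := svalP (F k.+1); apply.
  by rewrite fE//; have [h _] := hu a; rewrite (h k.+1 aB).
have [_ fH] := hf.
have fE' : (fine (H f))%:E = H f by rewrite fineK// ge0_fin_numE// hardy_norm_pow_ge0.
have := big (Num.truncn (fine (H f))); rewrite -fE' lte_fin ltNge => /negP; apply.
by apply: ltW; exact: truncnS_gt.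
Qed.

End uniform_interpolation.

(** * Random signs and Young's inequality *)

Section random_signs.
Variable m : nat.
Local Notation E := {ffun 'I_m -> bool}.

(** Distinct coordinate signs are orthogonal: flip one of them. *)
Lemma sum_signs (R : realType) (i j : 'I_m) :
  \sum_(e : E) (-1) ^+ e i * (-1) ^+ e j = (if i == j then #|E|%:R else 0) :> R.
Proof.
have [<-|ij] := eqVneq i j.
  by under eq_bigr do rewrite -signr_addb addbb expr0; rewrite sumr_const.
pose flip (e : E) : E := [ffun k => (k == i) (+) e k].
have flipK : involutive flip.
  by move=> e; apply/ffunP => k; rewrite !ffunE addKb.
set s := \sum_(_ | _) _; have : s = - s.
  rewrite {1}/s (reindex_inj (inv_inj flipK)) /= /s -sumrN; apply: eq_bigr => e _.
  have ji : (j == i) = false by rewrite eq_sym (negbTE ij).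
  by rewrite !ffunE eqxx ji /= signrN mulNr.
lra.
Qed.

(** Bessel's inequality for the orthogonal system of coordinate signs on [{-1, 1}^m]. *)
Lemma bessel_signs_real (R : realType) (x : E -> R) :
  \sum_(i < m) (#|E|%:R^-1 * \sum_(e : E) (-1) ^+ e i * x e) ^+ 2 <=
  #|E|%:R^-1 * \sum_(e : E) x e ^+ 2.
Proof.
have N0 : (0 : R) < #|E|%:R by rewrite ltr0n; apply/card_gt0P; exists [ffun=> true].
set N : R := #|E|%:R in N0 *.
pose c i := N^-1 * \sum_(e : E) (-1) ^+ e i * x e.
rewrite -(ler_pM2l N0) mulrA divff ?lt0r_neq0// mul1r.
have cE i : \sum_(e : E) (-1) ^+ e i * x e = N * c i.
  by rewrite /c mulrA divff ?lt0r_neq0// mul1r.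
have : 0 <= \sum_(e : E) (x e - \sum_i (-1) ^+ e i * c i) ^+ 2.
  by apply: sumr_ge0 => e _; exact: sqr_ge0.
have -> : \sum_(e : E) (x e - \sum_i (-1) ^+ e i * c i) ^+ 2 =
   \sum_(e : E) x e ^+ 2 - 2 * \sum_i c i * \sum_(e : E) (-1) ^+ e i * x e +
   \sum_i \sum_j c i * c j * \sum_(e : E) (-1) ^+ e i * (-1) ^+ e j.
  under eq_bigr do rewrite sqrrB expr2.
  rewrite big_split /= sumrB; congr (_ - _ + _).
    rewrite mulr_sumr.
    under [RHS]eq_bigr do rewrite !mulr_sumr.
    rewrite exchange_big /=; apply: eq_bigr => e _.
    by rewrite -mulr_natl mulrA mulr_sumr; apply: eq_bigr => i _; ring.
  under [RHS]eq_bigr do (under eq_bigr do rewrite mulr_sumr; rewrite exchange_big /=).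
  rewrite exchange_big /=; apply: eq_bigr => e _.
  rewrite expr2 mulr_suml; apply: eq_bigr => i _.
  by rewrite mulr_sumr; apply: eq_bigr => j _; ring.
have -> : \sum_i \sum_j c i * c j * \sum_(e : E) (-1) ^+ e i * (-1) ^+ e j = N * \sum_i c i ^+ 2.
  rewrite mulr_sumr; apply: eq_bigr => i _.
  rewrite (bigD1 i)//= sum_signs eqxx big1 => [|j ji]; first by rewrite /N; ring.
  by rewrite sum_signs eq_sym (negbTE ji) mulr0.
have -> : \sum_i c i * \sum_(e : E) (-1) ^+ e i * x e = N * \sum_i c i ^+ 2.
  by rewrite mulr_sumr; apply: eq_bigr => i _; rewrite cE; ring.
rewrite -/c; lra.
Qed.

Lemma bessel_signs (R : realType) (z : E -> Cplx R) :
  \sum_(i < m) modulus ((#|E|%:R^-1)%:C%C * \sum_(e : E) (-1) ^+ e i * z e) ^+ 2 <=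
  #|E|%:R^-1 * \sum_(e : E) modulus (z e) ^+ 2.
Proof.
have reim (c : R) (f : E -> Cplx R) :
    complex.Re (c%:C%C * \sum_(e : E) f e) = c * \sum_(e : E) complex.Re (f e) /\
    complex.Im (c%:C%C * \sum_(e : E) f e) = c * \sum_(e : E) complex.Im (f e).
  have -> : \sum_(e : E) complex.Re (f e) = complex.Re (\sum_(e : E) f e).
    by apply/esym; apply: (big_morph (@complex.Re R)) => // -[? ?] [? ?].
  have -> : \sum_(e : E) complex.Im (f e) = complex.Im (\sum_(e : E) f e).
    by apply/esym; apply: (big_morph (@complex.Im R)) => // -[? ?] [? ?].
  by case: (\sum_(e : E) f e) => u v /=; rewrite !mul0r subr0 addr0.
have sgn (b : bool) (w : Cplx R) : complex.Re ((-1) ^+ b * w) = (-1) ^+ b * complex.Re w /\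
    complex.Im ((-1) ^+ b * w) = (-1) ^+ b * complex.Im w.
  by case: b; case: w => u v; rewrite ?expr0 ?expr1 ?mul1r ?mulN1r.
under eq_bigr => i _.
  rewrite sqr_modulus; have [-> ->] := reim #|E|%:R^-1 (fun e => (-1) ^+ e i * z e).
  under eq_bigr do rewrite (sgn _ _).1.
  under [X in _ + (_ * X) ^+ 2]eq_bigr do rewrite (sgn _ _).2.
  over.
have -> : \sum_(e : E) modulus (z e) ^+ 2 =
    \sum_(e : E) complex.Re (z e) ^+ 2 + \sum_(e : E) complex.Im (z e) ^+ 2.
  by rewrite -big_split; apply: eq_bigr => e _; exact: sqr_modulus.
by rewrite big_split /= mulrDr; apply: lerD; exact: bessel_signs_real.
Qed.

End random_signs.

Section young.
Variable R : realType.

Lemma powR_addr (x a b : R) : 0 <= x -> 0 < a -> 0 < b -> x `^ (a + b) = x `^ a * x `^ b.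
Proof.
rewrite le_eqVlt => /predU1P[<-|x0] a0 b0; last by rewrite powRD// (gt_eqF x0) implybT.
by rewrite !powR0 ?mul0r// lt0r_neq0// addr_gt0.
Qed.

(** Young's inequality for the exponents [p / (p - 2)] and [p / 2], with an arbitrarily small
    constant in front of the second term. *)
Lemma young_square (p k x y : R) : 2 < p -> 0 < k -> 0 <= x -> 0 <= y ->
  x * y ^+ 2 <= k^-1 `^ (2 / (p - 2)) * x `^ (p / (p - 2)) + k * y `^ p.
Proof.
move=> p2 k0 x0 y0.
have s0 : 0 < p - 2 by lra.
have [xy|xy] := leP x (k * y `^ (p - 2)).
  apply: ler_wpDl; first by rewrite mulr_ge0 ?powR_ge0.
  apply: le_trans (ler_wpM2r (sqr_ge0 y) xy) _.
  rewrite -mulrA ler_pM2l// -powR_mulrn// -powR_addr//.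
  by rewrite subrK.
have x1 : 0 < x by apply: le_lt_trans xy; rewrite mulr_ge0 ?powR_ge0 ?ltW.
apply: ler_wpDr; first by rewrite mulr_ge0 ?powR_ge0 ?ltW.
have -> : y ^+ 2 = (y `^ (p - 2)) `^ (2 / (p - 2)).
  by rewrite -powRrM mulrCA divff ?lt0r_neq0// mulr1 powR_mulrn.
have -> : p / (p - 2) = 2 / (p - 2) + 1 by field; rewrite lt0r_neq0.
have q0 : 0 < 2 / (p - 2) by rewrite divr_gt0.
rewrite (powR_addr x0 q0 ltr01) powRr1// mulrA mulrC ler_pM2r// -powRM ?invr_ge0 ?(ltW k0)//.
apply: ge0_ler_powR; rewrite ?nnegrE ?powR_ge0//.
- by rewrite divr_ge0// ltW.
- by rewrite mulr_ge0// ?invr_ge0 ltW.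
by rewrite ler_pdivlMl// ltW.
Qed.

End young.

(** * The Carleson embedding *)

Section carleson_embedding.
Variables (R : realType) (n : nat) (p : R) (S : set 'rV[Cplx R]_n).
Hypotheses (p2 : 2 < p) (S1 : S `<=` @polydisc R n) (intS : interpolating p S).
Local Notation C := (Cplx R).

Let p0 : 0 < p. Proof. by apply: lt_trans p2; rewrite ltr0n. Qed.
Let q := p / (p - 2).

Let q_gt1 : 1 < q.
Proof. by rewrite /q ltr_pdivlMr ?subr_gt0// mul1r gtrBl. Qed.

Let q0 : 0 < q. Proof. exact: lt_trans ltr01 q_gt1. Qed.

Lemma weight_gt0 a : S a -> 0 < weight a.
Proof.
move=> /S1 a1; apply: prodr_gt0 => j _; rewrite subr_gt0.
by rewrite expr_lt1 ?modulus_ge0 ?a1.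
Qed.

(** The interpolating functions [F e] of the families [e i * c i], averaged against the sign [e i],
    yield [rho i] with value [c i] at the [i]-th point, and by Bessel's inequality the square
    function of the [rho i] is dominated by the mean of [|F e| ^ 2]. *)
Lemma square_function_family (A : seq 'rV[C]_n) (c : 'rV[C]_n -> R) (K : R) :
  interpolates_with p S K -> uniq A -> (forall a, a \in A -> S a) -> (forall a, 0 <= c a) ->
  let E := {ffun 'I_(size A) -> bool} in
  exists (F : E -> 'rV[C]_n -> C) (rho : 'I_(size A) -> 'rV[C]_n -> C),
  [/\ forall e, hardy p (F e) /\
        (hardy_norm_pow p (F e) <= (K * \sum_(a <- A) weight a * c a `^ p)%:E)%E,
      forall i, holomorphic (rho i) /\
        rho i (tnth (in_tuple A) i) = (c (tnth (in_tuple A) i))%:C%C &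
      forall z, \sum_i modulus (rho i z) ^+ 2 <= #|E|%:R^-1 * \sum_e modulus (F e z) ^+ 2].
Proof.
move=> intK uA AS c0 E; set pt := tnth (in_tuple A).
have pt_inj : injective pt by apply/tuple_uniqP.
have ptA i : pt i \in A by exact: mem_tnth.
have ptS i : S (pt i) by apply: AS.
(* Off [A], the value of [sgn e] is irrelevant. *)
pose sgn (e : E) a : C := if [pick i | pt i == a] is Some i then (-1) ^+ e i else 1.
have sgnE e i : sgn e (pt i) = (-1) ^+ e i.
  rewrite /sgn; case: pickP => [j /eqP/pt_inj -> //|/(_ i)].
  by rewrite eqxx.
have msgn e a : modulus (sgn e a) = 1.
  rewrite /sgn; case: pickP => [j _|_]; last by rewrite -[1 : C]/((1%:C)%C) modulus_real normr1.
  by rewrite modulusX modulusN -[1 : C]/((1%:C)%C) modulus_real normr1 expr1n.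
pose lam (e : E) a : C := (weight a `^ p^-1)%:C%C * ((c a)%:C%C * sgn e a).
have sumE e : \sum_(a <- A) modulus (lam e a) `^ p = \sum_(a <- A) weight a * c a `^ p.
  apply: eq_big_seq => a aA; rewrite /lam !modulusM msgn mulr1 !modulus_real.
  rewrite !ger0_norm ?powR_ge0// powRM ?powR_ge0// -powRrM mulVf ?lt0r_neq0// powRr1//.
  exact: ltW (weight_gt0 (AS a aA)).
have [F FP] := choice (fun e => intK A (lam e) uA AS).
have Fpt e i : F e (pt i) = (c (pt i))%:C%C * (-1) ^+ e i.
  have [_ /(_ _ (ptA i)) + _] := FP e; rewrite /restriction /lam sgnE => h.
  have w0 : (weight (pt i) `^ p^-1)%:C%C != 0 :> C.
    by rewrite -[0 : C]/((0%:C)%C) (inj_eq (@complexI R)) lt0r_neq0// powR_gt0// weight_gt0.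
  exact: (mulfI w0 h).
have N0 : (#|E|%:R : R) != 0.
  by rewrite lt0r_neq0// ltr0n; apply/card_gt0P; exists [ffun=> true].
pose rho i z := (#|E|%:R^-1)%:C%C * \sum_(e : E) (-1) ^+ e i * F e z.
exists F, rho; split.
- by move=> e; have [h1 _ h2] := FP e; rewrite -(sumE e).
- move=> i; split.
    move=> z z1.
    apply: (@differentiableM _ _ (fun=> _) (fun z => \sum_(e : E) (-1) ^+ e i * F e z)).
      exact: differentiable_cst.
    have H (s : seq E) : differentiable (fun z => \sum_(e <- s) (-1) ^+ e i * F e z) z.
      elim: s => [|e s IH].
        under eq_fun do rewrite big_nil; exact: differentiable_cst.
      under eq_fun do rewrite big_cons.
      apply: (@differentiableD _ _ _ (fun z => (-1) ^+ e i * F e z)); last exact: IH.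
      apply: (@differentiableM _ _ (fun=> _) (F e)); first exact: differentiable_cst.
      by have [[hF _] _ _] := FP e; exact: hF.
    exact: H.
  rewrite /rho -/(pt i).
  under eq_bigr do rewrite Fpt mulrCA -signr_addb addbb expr0 mulr1.
  have sum_cst (x : C) : \sum_(e : E) x = (#|E|%:R : R)%:C%C * x.
    by rewrite sumr_const rmorph_nat mulr_natl.
  rewrite sum_cst mulrA -rmorphM /=.
  by rewrite mulVf// mul1r.
- by move=> z; exact: bessel_signs.
Qed.

(** The Carleson embedding for [q = p / (p - 2)], with one constant for all the finite
    subsets of [S]. *)
Lemma carleson_finite : exists2 M : R, 0 < M & forall g A, hardy q g -> uniq A ->
  (forall a, a \in A -> S a) ->
  \sum_(a <- A) weight a * modulus (g a) `^ q <= M * fine (hardy_norm_pow q g).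
Proof.
have [K K0 intK] := interpolating_uniform p0 intS.
pose K0n : R := 4 ^+ n.
have K0n0 : 0 < K0n by rewrite exprn_gt0.
(* [k] makes the second term of Young's inequality contribute [X / 2]. *)
pose k := (2 * K0n * K)^-1.
have k0 : 0 < k by rewrite invr_gt0 !mulr_gt0.
pose L := k^-1 `^ (2 / (p - 2)).
have L0 : 0 < L by rewrite powR_gt0// invr_gt0.
exists (2 * K0n * L); first by rewrite !mulr_gt0.
move=> g A hg uA AS; set X := \sum_(a <- A) _.
(* The exponent is such that [c a ^ 2 * |g a|] and [c a ^ p] are both [|g a| ^ q]. *)
pose c a := modulus (g a) `^ ((q - 1) / 2).
have c0 a : 0 <= c a by exact: powR_ge0.
have q10 : 0 < q - 1 by rewrite subr_gt0.
have c2 a : c a ^+ 2 * modulus (g a) = modulus (g a) `^ q.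
  rewrite -[in RHS](subrK 1 q).
  rewrite (powR_addr (modulus_ge0 _) q10 ltr01) powRr1 ?modulus_ge0//; congr (_ * _).
  by rewrite -powR_mulrn ?powR_ge0// /c -powRrM divfK.
have cp a : c a `^ p = modulus (g a) `^ q.
  rewrite /c -powRrM; congr (_ `^ _); rewrite /q; field.
  by rewrite subr_eq0 gt_eqF.
have [F [rho [FP rhoP sq]]] := square_function_family intK uA AS c0.
have XE : \sum_(a <- A) weight a * c a `^ p = X by apply: eq_bigr => a _; rewrite cp.
rewrite XE in FP.
have [r r01 sub] := weighted_submean (fun a aA => S1 (AS a aA)).
pose G := fine (hardy_norm_pow q g).
have GE : G%:E = hardy_norm_pow q g.
  by rewrite /G fineK// ge0_fin_numE ?hardy_norm_pow_ge0//; case: hg.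
rewrite -/G.
pose T := torus_measure R n.
have hol i : holomorphic (fun z => g z * rho i z ^+ 2).
  move=> z z1; apply: (differentiableM (f := g)); first by case: hg => + _; apply.
  under eq_fun do rewrite expr2.
  by have [h _] := rhoP i; apply: (differentiableM (f := rho i) (g := rho i)); exact: h.
have mhol f : holomorphic f -> measurable_fun setT
    (fun s : n.-tuple (measurableTypeR R) => (modulus (f (polar r s)))%:E).
  move=> hf; apply/measurable_EFinP.
  exact: measurable_modulus_polar r01 (holomorphic_separately hf).
pose N : R := #|{ffun 'I_(size A) -> bool}|%:R.
have N0 : 0 < N by rewrite ltr0n; apply/card_gt0P; exists [ffun=> true].
have main : (X%:E <= K0n%:E * (L%:E * G%:E + k%:E * (K * X)%:E))%E.
  apply: (@le_trans _ _ (K0n%:E * \int[T]_s \sum_(i < size A)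
      (modulus (g (polar r s) * rho i (polar r s) ^+ 2))%:E)%E).
    rewrite ge0_integral_sum//; last 2 first.
    - by move=> i; exact: (mhol _ (hol i)).
    - by move=> i s _; rewrite lee_fin modulus_ge0.
    rewrite ge0_sume_distrr; last first.
      by move=> i _; apply: integral_ge0 => s _; rewrite lee_fin modulus_ge0.
    rewrite /X big_tnth -sumEFin; apply: lee_sum => i _.
    have [_ rE] := rhoP i.
    have := sub _ _ (mem_tnth i (in_tuple A)) (hol i); rewrite rE.
    by rewrite modulusM modulusX modulus_real ger0_norm// [modulus _ * _]mulrC c2.
  apply: lee_wpmul2l; first by rewrite lee_fin ltW.
  apply: (@le_trans _ _ (\int[T]_s (L%:E * (modulus (g (polar r s)) `^ q)%:E +
      (k / N)%:E * \sum_(e : {ffun 'I_(size A) -> bool}) (modulus (F e (polar r s)) `^ p)%:E))%E).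
    apply: ge0_le_integral => //.
    - by move=> s _; apply: sume_ge0 => i _; rewrite lee_fin modulus_ge0.
    - by apply: emeasurable_sum => i; exact: (mhol _ (hol i)).
    - apply: emeasurable_funD; apply: measurable_funeM.
        by apply: measurable_modulus_pow => //; case: hg.
      apply: emeasurable_sum => e; apply: measurable_modulus_pow => //.
      by have [[]] := FP e.
    move=> s _; set z := polar r s.
    rewrite !sumEFin -!EFinM -EFinD lee_fin.
    under eq_bigr do rewrite modulusM modulusX.
    rewrite -mulr_sumr.
    apply: le_trans (ler_wpM2l (modulus_ge0 _) (sq z)) _.
    rewrite mulrCA mulr_sumr -/N.
    apply: (@le_trans _ _ (N^-1 * \sum_(e : {ffun 'I_(size A) -> bool})
       (L * modulus (g z) `^ q + k * modulus (F e z) `^ p))).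
      apply: ler_wpM2l; first by rewrite invr_ge0 ltW.
      by apply: ler_sum => e _; apply: young_square; rewrite ?modulus_ge0.
    rewrite big_split /= sumr_const -mulr_natl -/N -mulr_sumr.
    rewrite mulrDr mulKf ?lt0r_neq0// lerD2l mulrA [N^-1 * k]mulrC.
    exact: lexx.
  rewrite ge0_integralD//; last 4 first.
  - by move=> s _; rewrite mule_ge0// lee_fin ?powR_ge0 ?ltW.
  - by apply: measurable_funeM; apply: measurable_modulus_pow => //; case: hg.
  - move=> s _; rewrite mule_ge0//; first by rewrite lee_fin divr_ge0// ltW.
    by apply: sume_ge0 => e _; rewrite lee_fin powR_ge0.
  - apply: measurable_funeM; apply: emeasurable_sum => e; apply: measurable_modulus_pow => //.
    by have [[]] := FP e.
  apply: leeD.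
    rewrite ge0_integralZl//.
    - by apply: lee_wpmul2l; [rewrite lee_fin ltW|rewrite GE; exact: le_hardy_norm_pow].
    - by apply: measurable_modulus_pow => //; case: hg.
    - by move=> s _; rewrite lee_fin powR_ge0.
    - by rewrite lee_fin ltW.
  rewrite ge0_integralZl//; last 3 first.
  - apply: emeasurable_sum => e; apply: measurable_modulus_pow => //.
    by have [[]] := FP e.
  - by move=> s _; apply: sume_ge0 => e _; rewrite lee_fin powR_ge0.
  - by rewrite lee_fin divr_ge0// ltW.
  rewrite ge0_integral_sum//; last 2 first.
  - by move=> e; apply: measurable_modulus_pow => //; have [[]] := FP e.
  - by move=> e s _; rewrite lee_fin powR_ge0.
  apply: (@le_trans _ _ ((k / N)%:E * \sum_(e : {ffun 'I_(size A) -> bool}) (K * X)%:E)%E).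
    apply: lee_wpmul2l; first by rewrite lee_fin divr_ge0// ltW.
    apply: lee_sum => e _; have [_ h] := FP e; apply: le_trans h.
    exact: le_hardy_norm_pow.
  rewrite sumEFin -!EFinM lee_fin sumr_const -mulr_natl -/N mulrA divfK ?lt0r_neq0//.
have {}main : X <= K0n * (L * G + k * (K * X)) by rewrite -lee_fin; exact: main.
have e1 : K0n * (k * (K * X)) = X / 2.
  by rewrite /k; field; rewrite !lt0r_neq0.
rewrite mulrDr e1 in main.
by rewrite -!mulrA; lra.
Qed.

Lemma interpolating_carleson : carleson S.
Proof.
have [M M0 hM] := carleson_finite.
exists q; split; first exact: ltW.
exists (M `^ q^-1); first exact: powR_gt0.
move=> g hg; pose G := fine (hardy_norm_pow q g).
have GE : G%:E = hardy_norm_pow q g.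
  by rewrite /G fineK// ge0_fin_numE ?hardy_norm_pow_ge0//; case: hg.
have G0 : 0 <= G by rewrite -lee_fin GE hardy_norm_pow_ge0.
rewrite /ell_norm /hardy_norm -GE -poweR_EFin -poweRM ?lee_fin ?(ltW M0)// -EFinM.
have MG0 : 0 <= M * G by rewrite mulr_ge0// ltW.
have le : (\esum_(a in S) (modulus (restriction q g a) `^ q)%:E <= (M * G)%:E)%E.
  apply: esum_le_seq => [a|X uX XS]; first exact: powR_ge0.
  apply: le_trans (hM g X hg uX XS); rewrite le_eqVlt; apply/orP; left; apply/eqP.
  apply: eq_big_seq => a aX; rewrite /restriction modulusM modulus_real ger0_norm ?powR_ge0//.
  rewrite powRM ?powR_ge0 ?modulus_ge0// -powRrM mulVf ?lt0r_neq0// powRr1//.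
  exact: ltW (weight_gt0 (XS a aX)).
apply: gt0_ler_poweR => //; first by rewrite invr_ge0 ltW.
- rewrite in_itv /= leey andbT; apply: esum_ge0 => a _; rewrite lee_fin; exact: powR_ge0.
- by rewrite in_itv /= leey andbT lee_fin.
Qed.

End carleson_embedding.

Theorem theorem1p11 (R : realType) (n : nat) (p : R) (S : set 'rV[Cplx R]_n) :
  (0 < n)%N -> 2 < p -> point_sequence S -> interpolating p S -> carleson S.
Proof. by move=> _ p2 [_ S1] intS; exact: (interpolating_carleson p2 S1 intS). Qed.
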